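(* Let $d\ge 2$, $k\ge 1$ be integers and $T=(1,2,\ldots,d-1,d^k,d-1,\ldots,2,1)$ ($d$ occurring $k$ times). Let $P$ be a partition having diagonal lengths $T$. Then $P$ is a complete intersection Jordan type (CIJT) if and only if the number of parts of $P$ is either $d$ or $d+k-1$.
   Context: $\mathsf k$ is an infinite field of characteristic zero or of characteristic greater than $j:=2d+k-3$, and $R=\mathsf k[x,y]$ with the standard grading. Here $T_i=i+1$ for $0\le i\le d-1$, $T_i=d$ for $d-1\le i\le d+k-2$, $T_i=j+1-i$ for $d+k-2\le i\le j$. A partition $P=(p_1\ge p_2\ge\cdots\ge p_s>0)$ has Ferrers diagram with boxes $(r,c)$, $1\le r\le s$, $1\le c\le p_r$. Its diagonal lengths are the sequence $(t_0,t_1,\ldots)$ with $t_i=\#\{(r,c): r+c-2=i\}$. For a graded Artinian quotient $A=R/I$ and a nonzero linear form $\ell\in R_1$, the Jordan type $P_{\ell,A}$ is the partition of $\dim_{\mathsf k}A$ given by the Jordan block sizes of the nilpotent multiplication map $m_\ell:A\to A$, $a\mapsto \ell a$. A partition $P$ of diagonal lengths $T$ is a complete intersection Jordan type (CIJT) if $P=P_{\ell,A}$ for some graded Artinian complete intersection quotient $A=R/I$ (necessarily of Hilbert function $T$) and some nonzero linear form $\ell$. *)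

(* Defs.v *)
From HB Require Import structures.
From mathcomp Require Import all_boot all_order all_algebra all_field.
From mathcomp Require Export mpoly.

Set Implicit Arguments.
Unset Strict Implicit.
Unset Printing Implicit Defensive.

Import GRing.Theory.

Local Open Scope ring_scope.

Definition is_partition (p : seq nat) : bool := sorted geq p && (0%N \notin p).

(* Boxes are indexed from 0, so the box (r, c) lies on the diagonal r + c. *)
Definition ferrers (p : seq nat) : seq (nat * nat) :=
  [seq (r, c) | r <- iota 0 (size p), c <- iota 0 (nth 0%N p r)].

Definition diag_length (p : seq nat) (i : nat) : nat :=
  count (fun b => b.1 + b.2 == i)%N (ferrers p).

(* (1, 2, ..., d-1, d^k, d-1, ..., 2, 1) *)
Definition seqT (d k : nat) : seq nat :=
  iota 1 d.-1 ++ nseq k d ++ rev (iota 1 d.-1).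

Definition has_diag_lengths (p T : seq nat) : Prop :=
  forall i : nat, diag_length p i = nth 0%N T i.

Definition infinite_type (K : eqType) : Prop :=
  forall s : seq K, exists x : K, x \notin s.

Definition ideal2 (R : comNzRingType) (f g : R) (h : R) : Prop :=
  exists a b : R, h = a * f + b * g.

Definition regular_pair (R : comNzRingType) (f g : R) : Prop :=
  [/\ forall h : R, f * h = 0 -> h = 0,
      forall h : R, (exists a : R, g * h = a * f) -> exists a : R, h = a * f
    & ~ ideal2 f g 1].

(* Matrices of linear maps act on row vectors: this nilpotent block sends the *)
(* i-th basis vector to the (i+1)-st one, and the last one to 0.              *)
Definition jordan_block (K : fieldType) (n : nat) : 'M[K]_n :=
  \matrix_(i, j) (i.+1 == j)%:R.

Definition jordan_mx (K : fieldType) (p : seq nat) :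
    'M[K]_(\sum_(i < size p) nth 0%N p i) :=
  \mxdiag_(i < size p) jordan_block K (nth 0%N p i).

Definition has_jordan_type (K : fieldType) (V : vectType K) (f : 'End(V))
    (p : seq nat) : Prop :=
  is_partition p /\
  exists e : (\sum_(i < size p) nth 0%N p i).-tuple V,
    basis_of fullv e /\
    forall i, f (tnth e i) = \sum_j jordan_mx K p i j *: tnth e j.

(* phi identifies A with the quotient of {mpoly K[2]} by the ideal (f, g),    *)
(* where f, g is a regular sequence of forms. As an falgType, A has finite    *)
(* dimension over K, i.e. the quotient is Artinian.                           *)
Definition graded_CI_quotient (K : fieldType) (A : falgType K)
    (phi : {lrmorphism {mpoly K[2]} -> A}) : Prop :=
  (forall a : A, exists h : {mpoly K[2]}, phi h = a) /\
  exists f g : {mpoly K[2]}, exists m n : nat,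
    [/\ f \is m.-homog, g \is n.-homog, regular_pair f g
      & forall h : {mpoly K[2]}, phi h = 0 <-> ideal2 f g h].

Definition CIJT (K : fieldType) (p : seq nat) : Prop :=
  exists (A : falgType K) (phi : {lrmorphism {mpoly K[2]} -> A})
         (l : {mpoly K[2]}),
    [/\ graded_CI_quotient phi, l \is 1.-homog, l != 0
      & has_jordan_type (amull (phi l)) p].

(* Main.v *)
From HB Require Import structures.
From Stdlib Require Import IndefiniteDescription.
Require Import Defs.
From mathcomp Require Import all_boot all_order all_algebra all_field.
From mathcomp Require Import zify ring.

(* Put R = K[x, y], seen as K[y][x], with y the linear form under study. For a *)
(* graded quotient A = R/(F, G), multiplication by y makes A a direct sum of   *)
(* modules K[y]/(y^(p r)), and p is the Jordan type.                           *)
(*                                                                             *)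
(* If A is a complete intersection of degrees m and n, one may assume that F   *)
(* is monic in x of degree m and that y divides G. Then A/yA = K[x]/(x^m), so  *)
(* p has m parts. Comparing determinants over K[y] gives m n <= |p|, and the   *)
(* exact power of y dividing G bounds one of the parts. On the other side, for *)
(* a partition with diagonal lengths T the row ends r + p r go up by at most 1 *)
(* at each step, so they cannot jump over a gap in the set of their values:    *)
(* there are d or d + k - 1 parts, or more than d + k - 1, and the last case   *)
(* contradicts the two bounds.                                                 *)
(*                                                                             *)
(* Conversely, if p has s parts, s one of d, d + k - 1 and n the other, then   *)
(* the row ends a r are a permutation of n, ..., n + s - 1. Put W_0 = 1 and    *)
(* W_(r+1) = x W_r + y^(r+1-i) W_i, where i < r is the row with a i = a r + 1  *)
(* (no such term if there is none). Then F = W_s and G = y^(p r) W_r, where    *)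
(* a r = n, form a regular sequence and the sum of F R and of the              *)
(* K[y] y^(p r) W_r is the ideal (F, G), so that the quotient has type p.      *)

(** Both directions go through [cyclic_decomp], the form of a Jordan type over K[y]. After the
    change of coordinates [linear_coordinates], which turns the linear form into y,
    [CIJT_cyclic_decomp] and [cyclic_decomp_CIJT] pass between the two notions.

    Let N = d + k - 1 and let s be the number of parts. By [countT], T and s determine how many rows
    end at each diagonal.

    Necessity: [size_diagT] settles s <= N. In general [CI_type] gives n' and t <= n' with s n' <=
    |P| = d N such that, if t < s, the parts in rows 0, ..., t do not all exceed n' - t. If s > N,
    then n' < d; since every row end is at least d ([row_end_ge]), those parts do all exceed n' - t,
    a contradiction.

    Sufficiency: [perm_row_end] shows that the row ends fill an interval, which is what
    [exists_CI_cell] needs to build the two generators; [cyclic_decomp_regular] makes them a regular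
    sequence. *)

Set Implicit Arguments.
Unset Strict Implicit.
Unset Printing Implicit Defensive.

Import GRing.Theory.

(** * Partitions with given diagonal lengths *)

(* The first diagonal that row r of the diagram p does not reach. *)
Definition row_end (p : seq nat) (r : nat) : nat := r + nth 0 p r.

(** A row meets a diagonal in at most one box, so that boxes can be counted by rows. *)
Lemma diag_lengthE p i :
  diag_length p i = count (fun r => r <= i < row_end p r) (iota 0 (size p)).
Proof.
rewrite /diag_length /ferrers count_flatten -map_comp.
rewrite -sumn_count; congr sumn; apply: eq_map => r /=.
rewrite count_map /preim /=.
have -> : forall n, count (fun c => r + c == i) (iota 0 n) = (r <= i < r + n).
  elim=> [|n IHn]; first by rewrite addn0 /=; lia.
  by rewrite -[n.+1]addn1 iotaD count_cat IHn /= add0n; lia.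
by [].
Qed.

Lemma nth_seqT d k i :
  0 < d -> 0 < k ->
  nth 0 (seqT d k) i = minn (minn i.+1 d) (d + (d + k - 1) - 1 - i).
Proof.
move=> hd hk; rewrite /seqT !nth_cat size_iota size_nseq.
case: ltnP => h1; first by rewrite nth_iota //; lia.
rewrite nth_nseq; case: ltnP => h2; first lia.
case: (ltnP (i - d.-1 - k) d.-1) => h3; last by rewrite nth_default ?size_rev ?size_iota; lia.
by rewrite nth_rev ?size_iota // nth_iota; lia.
Qed.

Lemma sumn_seqT d k : 0 < d -> sumn (seqT d k) = d * (d + k - 1).
Proof.
move=> hd; rewrite /seqT !sumn_cat sumn_rev sumn_nseq.
have H : forall n, sumn (iota 1 n) * 2 = n * n.+1.
  elim=> [//|n IHn]; rewrite -[n.+1]addn1 iotaD sumn_cat /=; nia.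
have := H d.-1; nia.
Qed.

Lemma sumn_diag_length p M :
  (forall r, r < size p -> row_end p r <= M) ->
  sumn p = \sum_(i < M) diag_length p i.
Proof.
move=> hM; under eq_bigr do rewrite diag_lengthE -sum1_count big_mkcond.
rewrite exchange_big sumnE (big_nth 0) /index_iota subn0 /=.
apply: eq_big_seq => r; rewrite mem_iota add0n /= => /hM hr.
rewrite -big_mkcond /= -(big_mkord (fun i => r <= i < row_end p r) (fun=> 1)).
rewrite sum1_count /index_iota subn0.
have -> : forall N, count (fun i => r <= i < row_end p r) (iota 0 N) =
   minn N (row_end p r) - minn N r.
  elim=> [|N IHN]; first by rewrite !min0n.
  by rewrite -[N.+1]addn1 iotaD count_cat IHN /= add0n; lia.
by rewrite /row_end in hr *; lia.
Qed.

Lemma partition_nth_gt0 p r : is_partition p -> r < size p -> 0 < nth 0 p r.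
Proof.
by case/andP=> _ p0 hr; rewrite lt0n; apply: contra p0 => /eqP <-; rewrite mem_nth.
Qed.

Lemma partition_nthS p r : is_partition p -> nth 0 p r.+1 <= nth 0 p r.
Proof.
case/andP=> hs _; case: (ltnP r.+1 (size p)) => h; last by rewrite nth_default.
by move/(sortedP 0): hs => /(_ r h).
Qed.

Lemma row_endS p r : is_partition p -> row_end p r.+1 <= (row_end p r).+1.
Proof. by move/partition_nthS => /(_ r); rewrite /row_end; lia. Qed.

Lemma row_end_gt p r : is_partition p -> r < size p -> r < row_end p r.
Proof. by move=> hp /(partition_nth_gt0 hp); rewrite /row_end; lia. Qed.

(** Exactly the rows of index at most i start by diagonal i, and each of them has either ended or
    meets the diagonal. Conversely a row that has ended did start, its part being positive. *)
Lemma count_row_end p i : is_partition p ->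
  count (fun r => row_end p r <= i) (iota 0 (size p)) + diag_length p i
    = minn i.+1 (size p).
Proof.
move=> hp; rewrite diag_lengthE -count_predUI.
rewrite [X in _ + X](_ : _ = 0) ?addn0; last first.
  by apply/eqP; rewrite -leqn0 leqNgt -has_count -all_predC; apply/allP => r /= _; lia.
rewrite (@eq_in_count _ _ (fun r => r < i.+1)); last first.
  move=> r; rewrite mem_iota add0n /= => /(row_end_gt hp); lia.
elim: (size p) => [|n IHn]; first by rewrite minn0.
by rewrite -[n.+1]addn1 iotaD count_cat IHn /= add0n; lia.
Qed.

Lemma count_iotaP (P : pred nat) n :
  reflect (exists2 r, r < n & P r) (0 < count P (iota 0 n)).
Proof.
rewrite -has_count; apply: (iffP hasP).
  by case=> r; rewrite mem_iota add0n /= => h1 h2; exists r.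
by case=> r h1 h2; exists r; rewrite ?mem_iota.
Qed.

Section DiagT.

Variables (d k : nat) (p : seq nat).
Hypotheses (hd : 0 < d) (hk : 0 < k) (hp : is_partition p).
Hypothesis hT : has_diag_lengths p (seqT d k).
Let N := d + k - 1.

Lemma countT i :
  count (fun r => row_end p r <= i) (iota 0 (size p)) +
    minn (minn i.+1 d) (d + N - 1 - i) = minn i.+1 (size p).
Proof. by rewrite -nth_seqT // -hT count_row_end. Qed.

Lemma size_diagT_ge : d <= size p.
Proof. by have := countT d.-1; rewrite /N; lia. Qed.

Lemma row_end_ge r : r < size p -> d <= row_end p r.
Proof.
move=> hr; rewrite leqNgt; apply/negP => hlt.
have : 0 < count (fun r => row_end p r <= d.-1) (iota 0 (size p)).
  by apply/count_iotaP; exists r => //; lia.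
by have := countT d.-1; rewrite /N; lia.
Qed.

Lemma sumn_diagT : sumn p = d * N.
Proof.
pose M := d + N + \max_(r < size p) row_end p r.
have hM r : r < size p -> row_end p r <= M.
  move=> hr; rewrite (leq_trans _ (leq_addl _ _)) //.
  exact: (@leq_bigmax 'I_(size p) (fun r => row_end p r) (Ordinal hr)).
rewrite (sumn_diag_length hM) -sumn_seqT // sumnE.
have hs : size (seqT d k) <= M.
  by rewrite /seqT !size_cat size_rev !size_iota size_nseq /M /N; lia.
rewrite (eq_bigr (fun i : 'I_M => nth 0 (seqT d k) i)) => [|i _]; last exact: hT.
rewrite -(big_mkord xpredT (nth 0 (seqT d k))) (big_cat_nat (n := size (seqT d k))) //=.
rewrite [X in _ + X]big1_seq => [|i /andP[_]]; first by rewrite addn0 [RHS](big_nth 0).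
by rewrite mem_index_iota => /andP[h _]; rewrite nth_default.
Qed.

(** Equal counts at i and j leave no row end in the interval (i, j]. *)
Lemma count_row_end_gap i j :
  count (fun r => row_end p r <= i) (iota 0 (size p)) =
    count (fun r => row_end p r <= j) (iota 0 (size p)) ->
  forall r, r < size p -> i < row_end p r -> j < row_end p r.
Proof.
move=> hij r hr hi; case: (leqP j i) => hji; first lia.
rewrite ltnNge; apply/negP => hj.
have hc : forall l, r < l -> count (fun r => row_end p r <= i) (iota 0 l) <
     count (fun r => row_end p r <= j) (iota 0 l).
  elim=> [//|l IHl hl]; rewrite -[l.+1]addn1 iotaD !count_cat /= add0n.
  case: (ltngtP r l) => [h|h|<-]; [by have := IHl h; lia | lia | ].
  have sub r' : row_end p r' <= i -> row_end p r' <= j by lia.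
  by have := sub_count sub (iota 0 r); lia.
by have := hc _ hr; lia.
Qed.

(* Row ends increase by at most 1 from one row to the next, so that they cannot *)
(* jump over the gap [size p, N) between the two ranges of their values.        *)
Lemma size_diagT : size p <= N -> size p = d \/ size p = N.
Proof.
move=> hN; have hds := size_diagT_ge.
case: (ltngtP d (size p)) hds => // [hs _|->]; last by left.
case: (ltngtP (size p) N) hN => // [hsN _|->]; last by right.
have [r hr hrd] : exists2 r, r < size p & row_end p r <= d.
  by apply/count_iotaP; have := countT d; lia.
have gap := @count_row_end_gap (size p).-1 (N.-1).
have {}gap r' : r' < size p -> (size p).-1 < row_end p r' -> N.-1 < row_end p r'.
  by apply: gap; have := countT (size p).-1; have := countT N.-1; lia.
(* From row r on, all ends stay below the gap; yet the last row ends beyond its own index, hence at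
   [size p] or later. *)
have low j : r + j < size p -> row_end p (r + j) < size p.
  elim: j => [|j IHj] hj; first by rewrite addn0; lia.
  have := row_endS (r + j) hp; have := IHj; have := gap (r + j.+1) hj.
  by rewrite addnS in hj *; lia.
have := low ((size p).-1 - r); have := @row_end_gt _ (size p).-1 hp.
by rewrite subnKC; lia.
Qed.

(** The multiplicity of v among the row ends is the difference of the counts that [countT] gives at
    v and v - 1. *)
Lemma perm_row_end n :
  (size p = d /\ n = N) \/ (size p = N /\ n = d) ->
  perm_eq [seq row_end p r | r <- iota 0 (size p)] (iota n (size p)).
Proof.
move=> hn; apply/allP => v _ /=; apply/eqP.
rewrite count_map (count_uniq_mem _ (iota_uniq _ _)) mem_iota; set c := count _ _.
have cv : c + count (fun r => row_end p r < v) (iota 0 (size p)) =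
          count (fun r => row_end p r <= v) (iota 0 (size p)).
  rewrite -count_predUI addnC (@eq_count _ _ pred0) ?count_pred0; last by move=> r /=; lia.
  by apply: eq_count => r /=; lia.
move: hn c cv (countT v) (countT v.-1); rewrite /N.
case: v => [|v] /= hn' c.
  by rewrite (@eq_count _ (fun r => row_end p r < 0) pred0) ?count_pred0 //; lia.
by rewrite (@eq_count _ (fun r => row_end p r < v.+1) (fun r => row_end p r <= v)) //; lia.
Qed.

End DiagT.

Local Open Scope ring_scope.

(** * Quotients of K[y][x] as modules over K[y] *)

Section Ideal2.

Variable R : comNzRingType.
Implicit Types f g h : R.

Lemma ideal2_gen1 f g : ideal2 f g f.
Proof. by exists 1, 0; ring. Qed.

Lemma ideal2_gen2 f g : ideal2 f g g.
Proof. by exists 0, 1; ring. Qed.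

Lemma ideal2_0 f g : ideal2 f g 0.
Proof. by exists 0, 0; ring. Qed.

Lemma ideal2D f g h1 h2 : ideal2 f g h1 -> ideal2 f g h2 -> ideal2 f g (h1 + h2).
Proof. by move=> [a [b ->]] [c [d ->]]; exists (a + c), (b + d); ring. Qed.

Lemma ideal2M f g h1 h2 : ideal2 f g h2 -> ideal2 f g (h1 * h2).
Proof. by move=> [a [b ->]]; exists (h1 * a), (h1 * b); ring. Qed.

Lemma ideal2N f g h : ideal2 f g h -> ideal2 f g (- h).
Proof. by move=> /(ideal2M (-1)); rewrite mulN1r. Qed.

Lemma ideal2B f g h1 h2 : ideal2 f g h1 -> ideal2 f g h2 -> ideal2 f g (h1 - h2).
Proof. by move=> h1P /ideal2N; apply: ideal2D. Qed.

Lemma ideal2_sum f g (I : Type) (r : seq I) (P : pred I) (h : I -> R) :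
  (forall i, P i -> ideal2 f g (h i)) -> ideal2 f g (\sum_(i <- r | P i) h i).
Proof. by move=> hP; elim/big_ind: _ => //; [exact: ideal2_0 | exact: ideal2D]. Qed.

Lemma ideal2_sub f g f' g' :
  ideal2 f' g' f -> ideal2 f' g' g -> forall h, ideal2 f g h -> ideal2 f' g' h.
Proof. by move=> hf hg h [a [b ->]]; apply: ideal2D; apply: ideal2M. Qed.

End Ideal2.

Section Bivariate.

Variable K : fieldType.
Local Notation B := {poly {poly K}}.
Implicit Types (F G h : B) (D E : nat).

(* Here x is 'X and y is 'X%:P, so that h`_i`_j is the coefficient of x^i y^j. *)
Definition bihomog D h : Prop := forall i j, (i + j != D)%N -> h`_i`_j = 0.

Lemma bihomogD D h1 h2 : bihomog D h1 -> bihomog D h2 -> bihomog D (h1 + h2).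
Proof. by move=> H1 H2 i j hij; rewrite !coefD H1 // H2 // addr0. Qed.

Lemma bihomogN D h : bihomog D h -> bihomog D (- h).
Proof. by move=> H i j hij; rewrite !coefN H // oppr0. Qed.

Lemma bihomogM D E h1 h2 :
  bihomog D h1 -> bihomog E h2 -> bihomog (D + E) (h1 * h2).
Proof.
move=> H1 H2 i j hij; rewrite coefM coef_sum big1 // => k _.
rewrite coefM big1 // => l _; have [e|e] := eqVneq (k + l)%N D.
  by rewrite H2 ?mulr0 //; have := ltn_ord k; have := ltn_ord l; lia.
by rewrite H1 ?mul0r.
Qed.

Lemma bihomogC c : bihomog 0 (c%:P%:P).
Proof. by move=> [|i] [|j] //=; rewrite !(coefC, coef0). Qed.

Lemma bihomogX : bihomog 1 'X.
Proof. by move=> [|[|i]] [|j] //=; rewrite !(coefX, coef1, coef0). Qed.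

Lemma bihomogY : bihomog 1 'X%:P.
Proof. by move=> [|i] [|[|j]] //=; rewrite !(coefC, coefX, coef1, coef0). Qed.

Lemma bihomogXn D h n : bihomog D h -> bihomog (n * D) (h ^+ n).
Proof.
move=> H; elim: n => [|n IHn]; first by rewrite expr0 mul0n; exact: (bihomogC 1).
by rewrite exprS mulSn; apply: bihomogM.
Qed.

Lemma bihomog_coefC D h i : (i <= D)%N -> bihomog D h -> bihomog (D - i) (h`_i)%:P.
Proof. by move=> hi H [|a] b hab; rewrite coefC ?coef0 //= H //; lia. Qed.

Lemma bihomog_coef0 D h i : bihomog D h -> (D < i)%N -> h`_i = 0.
Proof. by move=> H hi; apply/polyP => j; rewrite coef0 H //; lia. Qed.

Lemma bihomog_size D h : bihomog D h -> (size h <= D.+1)%N.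
Proof. by move=> H; apply/leq_sizeP => i hi; apply: bihomog_coef0 H _. Qed.

Lemma bihomog_coef D h i : (i <= D)%N -> bihomog D h ->
  h`_i = h`_i`_(D - i) *: 'X^(D - i).
Proof.
move=> hi H; apply/polyP => j; rewrite coefZ coefXn.
have [->|hj] := eqVneq; first by rewrite mulr1.
by rewrite mulr0 H //; lia.
Qed.

(* B / (F, G) is the direct sum over r < s of the cyclic modules K[y]/(y^(p r)), *)
(* generated by the classes of the e r.                                          *)
Definition cyclic_decomp F G s (p : nat -> nat) (e : nat -> B) : Prop :=
  (forall h, exists q : nat -> {poly K},
      ideal2 F G (h - \sum_(r < s) (q r)%:P * e r)) /\
  (forall q : nat -> {poly K}, ideal2 F G (\sum_(r < s) (q r)%:P * e r) <->
      forall r, (r < s)%N -> 'X^(p r) %| q r).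

Lemma inj_mulmx_leq a b (M : 'M[K]_(a, b)) :
  (forall u : 'rV_a, u *m M = 0 -> u = 0) -> (a <= b)%N.
Proof.
by move=> /inj_row_free /eqP <-; apply: rank_leq_col.
Qed.

(* The evaluation y = 0. *)
Definition ev0 : B -> {poly K} := map_poly (horner_eval 0).
HB.instance Definition _ := GRing.RMorphism.on ev0.

Lemma ev0X : ev0 'X = 'X.
Proof. exact: map_polyX. Qed.

Lemma ev0C q : ev0 q%:P = (q.[0])%:P.
Proof. exact: map_polyC. Qed.

Lemma ev0B h1 h2 : ev0 (h1 - h2) = ev0 h1 - ev0 h2.
Proof. exact: rmorphB. Qed.

Lemma coef_ev0 h i : (ev0 h)`_i = h`_i`_0.
Proof. by rewrite coef_map /= horner_evalE horner_coef0. Qed.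

Lemma ev0_eq0 h : ev0 h = 0 -> exists a, h = 'X%:P * a.
Proof.
move=> h0; exists (\poly_(i < size h) (h`_i %/ 'X)).
apply/polyP => i; rewrite coefCM coef_poly; case: ltnP => hi; last first.
  by rewrite mulr0 nth_default.
rewrite mulrC divpK // -['X]subr0 -polyC0 dvdp_XsubCl /root horner_coef0.
by rewrite -coef_ev0 h0 coef0.
Qed.

(** At y = 0 the s classes of the [e r] span a space that maps onto K[x]/(F0). Concretely, with
    fewer than deg F0 of them, some nontrivial combination of 1, x, ..., x^(deg F0 - 1) would be a
    multiple of F0. *)
Lemma cyclic_decomp_size_ge F G s p e (F0 : {poly K}) :
  cyclic_decomp F G s p e -> (forall h, ideal2 F G h -> F0 %| ev0 h) ->
  F0 != 0 -> ((size F0).-1 <= s)%N.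
Proof.
move=> [hspan _] hI F0n0; set m := (size F0).-1.
have [q hq] := fin_all_exists (fun i : 'I_m => hspan 'X^i).
apply: (@inj_mulmx_leq _ _ (\matrix_(i < m, r < s) (q i r).[0])) => u hu.
suff /eqP h0 : \sum_i u 0 i *: 'X^i == 0 :> {poly K}.
  apply/rowP => i; move/(congr1 (fun h : {poly K} => h`_i)): h0.
  rewrite coef_sum coef0 mxE (bigD1 i) //= coefZ coefXn eqxx mulr1 big1 ?addr0 //.
  by move=> j hj; rewrite coefZ coefXn [_ == _](negbTE _) ?mulr0 // eq_sym.
have hdvd : F0 %| \sum_i u 0 i *: 'X^i.
  have := hI _ (ideal2_sum (index_enum _) (P := xpredT)
     (fun i _ => ideal2M (u 0 i)%:P%:P (hq i))).
  rewrite rmorph_sum /=; congr (_ %| _).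
  under eq_bigr => i _ do rewrite rmorphM rmorphB rmorphXn rmorph_sum /= ev0X ev0C hornerC mulrBr mul_polyC.
  rewrite sumrB [X in _ - X](_ : _ = 0) ?subr0 //.
  under eq_bigr => i _ do rewrite mulr_sumr.
  rewrite exchange_big big1 //= => r _.
  under eq_bigr => i _ do rewrite rmorphM /= ev0C mulrA -polyCM.
  rewrite -mulr_suml -rmorph_sum /=.
  move/rowP/(_ r): hu; rewrite !mxE => hu.
  rewrite (eq_bigr (fun i => u 0 i * (\matrix_(i < m, r < s) (q i r).[0]) i r)) ?hu ?mul0r //.
  by move=> i _; rewrite mxE.
apply: contraT => h0.
have hsz : (size (\sum_i u 0 i *: 'X^i : {poly K})%R <= m)%N.
  apply: (leq_trans (size_sum _ _ _)); apply/bigmax_leqP => i _.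
  by apply: (leq_trans (size_scale_leq _ _)); rewrite size_polyXn ltn_ord.
have := leq_trans (dvdp_leq h0 hdvd) hsz.
by rewrite leqNgt prednK ?leqnn ?size_poly_gt0.
Qed.

(** In A = B/(F, G), the classes of y^a [e r] with [p r] > a are independent in y^a A / y^(a+1)
    A. *)
Lemma cyclic_decomp_free_mod F G s p e a (u : nat -> K) h :
  cyclic_decomp F G s p e ->
  ideal2 F G ('X%:P ^+ a * \sum_(r < s) (u r)%:P%:P * e r - 'X%:P ^+ a.+1 * h) ->
  forall r, (r < s)%N -> (a < p r)%N -> u r = 0.
Proof.
move=> [hspan hfree] hI r hr ha; have [q hq] := hspan h.
have /(_ _ r hr) := (hfree (fun i => 'X^a * (u i)%:P - 'X^(a.+1) * q i)).1.
have /[swap]/[apply] : ideal2 F G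
   (\sum_(i < s) ('X^a * (u i)%:P - 'X^(a.+1) * q i)%:P * e i).
  have := ideal2D hI (ideal2M ('X%:P ^+ a.+1) hq); congr (ideal2 _ _ _).
  rewrite mulrBr addrA subrK !mulr_sumr -sumrB; apply: eq_bigr => i _.
  by rewrite polyCB !polyCM !polyC_exp; ring.
rewrite exprSr -mulrA -mulrBr => /(dvdp_trans (dvdp_exp2l 'X ha)).
rewrite exprSr dvdp_mul2l ?expf_neq0 ?polyX_eq0 //.
by rewrite dvdp_subl ?dvdp_mulr // -['X]subr0 -polyC0 dvdp_XsubCl /root hornerC => /eqP.
Qed.

(** The ideal membership says that y^a A / y^(a+1) A is spanned by the y^a x^j with j < t, so at
    most t parts exceed a. *)
Lemma cyclic_decomp_part_le F G s p e a t h :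
  cyclic_decomp F G s p e ->
  ideal2 F G ('X%:P ^+ a * 'X^t - 'X%:P ^+ a.+1 * h) -> (t < s)%N ->
  ~ (forall r, (r <= t)%N -> (a < p r)%N).
Proof.
move=> he hI hts hp.
suff: (t.+1 <= t)%N by rewrite ltnn.
(* A combination w of e 0, ..., e t killed by this matrix is divisible by x^t at y = 0, so y^a w
   lies in the ideal modulo y^(a+1), and [cyclic_decomp_free_mod] applies. *)
apply: (@inj_mulmx_leq _ _ (\matrix_(r < t.+1, j < t) (e r)`_j`_0)) => u hu.
pose v r : K := if insub r is Some i then u 0 i else 0.
pose w := \sum_(r < t.+1) (v r)%:P%:P * e r.
have w_low j : (j < t)%N -> (ev0 w)`_j = 0.
  move=> hj; move/rowP/(_ (Ordinal hj)): hu; rewrite !mxE => hu; rewrite -[RHS]hu.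
  rewrite coef_ev0 !coef_sum; apply: eq_bigr => r _; rewrite !coefCM mxE /v.
  by rewrite valK.
have [w1 hw1] : exists w1, ev0 (w - map_poly polyC w1 * 'X^t) = 0.
  exists (drop_poly t (ev0 w)); rewrite rmorphB rmorphM rmorphXn /= ev0X.
  have -> : ev0 (map_poly polyC (drop_poly t (ev0 w))) = drop_poly t (ev0 w).
    by apply/polyP => i; rewrite coef_ev0 coef_map /= coefC eqxx.
  apply/polyP => i; rewrite coef0 coefB coefMXn coef_drop_poly.
  by case: ltnP => hi; [rewrite w_low ?subr0 | rewrite subnK ?subrr].
have [w2 hw2] := ev0_eq0 hw1.
have hw : \sum_(r < s) (if (r <= t)%N then v r else 0)%:P%:P * e r = w.
  rewrite /w (big_ord_widen s (fun r => (v r)%:P%:P * e r)) // [RHS]big_mkcond.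
  by apply: eq_bigr => r _; rewrite ltnS; case: ifP => // _; rewrite !polyC0 mul0r.
apply/rowP => r; rewrite mxE; have hr : (r <= t)%N by rewrite -ltnS.
have := @cyclic_decomp_free_mod F G s p e a (fun r => if (r <= t)%N then v r else 0)
   (w2 + map_poly polyC w1 * h) he _ r.
have vr : v r = u 0 r by rewrite /v valK.
rewrite hr vr hw; apply; [|lia|by apply: hp; lia].
move: (ideal2M (map_poly polyC w1) hI); congr (ideal2 _ _ _).
by move/(canRL (subrK _)): hw2 => ->; rewrite exprS; ring.
Qed.

End Bivariate.

(** * Division by a monic form, and the determinant bound on the dimension *)

Section MonicDivision.

Variable K : fieldType.
Local Notation B := {poly {poly K}}.
Implicit Types (F G h : B) (D E : nat).

(** Row vectors of length m encode, through [rVpoly], the remainders modulo a monic F of degree m; a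
    nonzero multiple of F has too large a degree to be one. *)
Lemma monic_rem0 (R : idomainType) m (F c : {poly R}) (v : 'rV[R]_m) :
  F \is monic -> size F = m.+1 -> rVpoly v = c * F -> v = 0.
Proof.
move=> Fm szF hv; suff c0 : c = 0.
  by move/(congr1 (@poly_rV _ m)): hv; rewrite c0 mul0r rVpolyK linear0.
apply/eqP; apply: contraT => cn0.
have := size_poly m (fun i => if insub i is Some j then v 0 j else 0).
rewrite -/(rVpoly v) hv size_Mmonic // szF.
by have := cn0; rewrite -size_poly_gt0; case: (size c) => // l _; lia.
Qed.

Lemma monic_div m F h : F \is monic -> size F = m.+1 ->
  exists a (v : 'rV[{poly K}]_m), h = a * F + rVpoly v.
Proof.
move=> Fm szF; exists (Pdiv.Ring.rdivp h F), (poly_rV (Pdiv.Ring.rmodp h F)).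
rewrite poly_rV_K -?Pdiv.RingMonic.rdivp_eq //.
by rewrite -ltnS -szF Pdiv.Ring.ltn_rmodpN0 // monic_neq0.
Qed.

(** Each step of long division subtracts a form of degree D, so that the remainder stays
    homogeneous. *)
Lemma bihomog_div m D F h :
  F \is monic -> size F = m.+1 -> bihomog m F -> bihomog D h ->
  exists a (v : 'rV[{poly K}]_m), h = a * F + rVpoly v /\ bihomog D (rVpoly v).
Proof.
move=> Fm szF hF; have [n] := ubnP (size h); elim: n h => // n IHn h; rewrite ltnS.
have [hm _ hD|hm hn hD] := leqP (size h) m.
  by exists 0, (poly_rV h); rewrite poly_rV_K // mul0r add0r.
case szh: (size h) hm hn => [//|N] hm hn.
have hN : lead_coef h = h`_N by rewrite /lead_coef szh.
have hN0 : h`_N != 0 by rewrite -hN lead_coef_eq0 -size_poly_gt0 szh.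
have hsD : (N <= D)%N by rewrite -ltnS -szh bihomog_size.
pose q : B := (h`_N)%:P * 'X^(N - m).
have hq : bihomog (D - m) q.
  have := bihomogM (bihomog_coefC hsD hD) (bihomogXn (n := N - m) (bihomogX K)).
  by congr bihomog; lia.
have hqF : bihomog D (q * F) by have := bihomogM hq hF; congr bihomog; lia.
have szqF : size (q * F) = N.+1.
  have q0 : q != 0 by rewrite mulf_neq0 ?expf_neq0 ?polyX_eq0 ?polyC_eq0.
  rewrite size_Mmonic // szF /q mul_polyC size_scale // size_polyXn; lia.
have [|a [v [hv hvD]]] := IHn (h - q * F) _ (bihomogD hD (bihomogN hqF)).
  apply: leq_trans hn; rewrite ltnS; apply/leq_sizeP => i; rewrite coefB.
  rewrite leq_eqVlt => /predU1P[<-|hi]; last by rewrite !nth_default ?subr0 ?szh ?szqF.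
  have -> : q * F = ((h`_N)%:P * F) * 'X^(N - m) by rewrite /q; ring.
  rewrite coefMXn ltnNge leq_subr /= subKn; last lia.
  rewrite coefCM; move/monicP: Fm; rewrite /lead_coef szF /= => ->.
  by rewrite mulr1 subrr.
by exists (a + q), v; split=> //; rewrite mulrDl -addrAC -hv subrK.
Qed.

(* Multiplying column j by y^j makes row i a constant multiple of y^(n + i). *)
Lemma det_bihomog m n (M : 'M[{poly K}]_m) :
  (forall (i j : 'I_m) l, (j + l != n + i)%N -> (M i j)`_l = 0) -> 'X^(m * n) %| \det M.
Proof.
move=> hM; pose C := \matrix_(i, j) (if (j <= n + i)%N then (M i j)`_(n + i - j) else 0)%:P.
have hC : M *m diag_mx (\row_j 'X^j) = diag_mx (\row_i 'X^(n + i)) *m C.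
  apply/matrixP => i j; rewrite mul_diag_mx mul_mx_diag !mxE.
  apply/polyP => l; rewrite coefMXn coefMC coefXn.
  case: ltnP => hl; case: leqP => hj; rewrite ?mulr0 //.
  - by rewrite (_ : (_ == _) = false) ?mul0r //; lia.
  - have [->|hl'] := eqVneq; first by rewrite mul1r.
    by rewrite mul0r hM //; lia.
  - by rewrite hM //; lia.
move/(congr1 determinant): hC; rewrite !det_mulmx !det_diag.
under [X in _ * X = _]eq_bigr => i _ do rewrite mxE.
under [X in _ = X * _]eq_bigr => i _ do rewrite mxE exprD.
rewrite big_split /= prodr_const card_ord -exprM mulnC -!mulrA [\prod_i _ * _]mulrC mulrA.
move/mulIf => ->; first exact: dvdp_mulr.
by apply/prodf_neq0 => i _; rewrite expf_neq0 ?polyX_eq0.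
Qed.

(* Modulo F, let E and H be the matrices of the e r and of the H_r such that    *)
(* y^(p r) e_r = H_r G, and M that of the x^i G. Then diag (y^(p r)) E = H M,   *)
(* where E is invertible at y = 0 and det M is a constant multiple of y^(m n).  *)
Lemma cyclic_decomp_dim_ge F G m n p e :
  F \is monic -> bihomog m F -> size F = m.+1 -> bihomog n G ->
  cyclic_decomp F G m p e -> (forall r, (r < m)%N -> (0 < p r)%N) ->
  (m * n <= \sum_(r < m) p r)%N.
Proof.
move=> Fm hF szF hG he hp.
have [a /fin_all_exists [v hv]] := fin_all_exists (fun r : 'I_m => monic_div (e r) Fm szF).
have hGi (i : 'I_m) : bihomog (n + i) (G * 'X^i).
  by have := bihomogM hG (bihomogXn (n := i) (bihomogX K)); congr bihomog; lia.
have [b /fin_all_exists [g hg]] := fin_all_exists (fun i => bihomog_div Fm szF hF (hGi i)).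
have hH (r : 'I_m) : exists w : 'rV[{poly K}]_m,
    'X^(p r) *: v r = w *m \matrix_i g i.
  have [|c [d hcd]] := (he.2 (fun i => if i == r then 'X^(p r) else 0)).2.
    by move=> i hi; case: eqP => [->|_] //; rewrite ?dvdp0.
  (* Only the remainder w of the cofactor d of G matters modulo F: it is row r of the matrix H. *)
  have [d' [w hw]] := monic_div d Fm szF.
  exists w; apply/eqP; rewrite -subr_eq0; apply/eqP.
  apply: (monic_rem0 (c := c + d' * G + \sum_i (w 0 i)%:P * b i - ('X^(p r))%:P * a r) Fm szF).
  rewrite linearB linearZ /= mulmx_sum_row linear_sum /=.
  have wE : rVpoly w = \sum_i (w 0 i)%:P * 'X^i.
    rewrite [w in LHS]row_sum_delta linear_sum; apply: eq_bigr => i _.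
    by rewrite linearZ /= rVpoly_delta mul_polyC.
  have -> : \sum_i rVpoly (w 0 i *: row i (\matrix_i g i)) =
     rVpoly w * G - (\sum_i (w 0 i)%:P * b i) * F.
    rewrite wE !mulr_suml -sumrB; apply: eq_bigr => i _.
    rewrite linearZ /= rowK -mul_polyC -[RHS]mulr1.
    have [hgi _] := hg i; have -> : rVpoly (g i) = G * 'X^i - b i * F by rewrite hgi; ring.
    by ring.
  have -> : 'X^(p r) *: rVpoly (v r) = ('X^(p r))%:P * e r - ('X^(p r))%:P * a r * F.
    by rewrite {1}(hv r) -mul_polyC; ring.
  have -> : ('X^(p r))%:P * e r = c * F + d * G.
    rewrite -hcd (bigD1 r) //= eqxx big1 ?addr0 // => i hi.
    by rewrite (_ : (_ == _) = false) ?polyC0 ?mul0r //; apply: contraNF hi.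
  by rewrite hw; ring.
have [w hw] := fin_all_exists hH.
pose E := \matrix_i v i.
(* A row relation of E at y = 0 would put a constant combination of the [e r] in (F) + (y), against
   [cyclic_decomp_free_mod] with a = 0. *)
have detE0 : (\det E).[0] != 0.
  rewrite -horner_evalE -det_map_mx -unitfE -unitmxE -row_free_unit.
  apply: inj_row_free => u hu.
  pose u' r : K := if insub r is Some i then u 0 i else 0.
  have hu' (i : 'I_m) : u' i = u 0 i by rewrite /u' valK.
  have hE0 : ev0 (rVpoly (map_mx polyC u *m E)) = 0.
    apply/polyP => j; rewrite coef_ev0 coef0 coef_rVpoly.
    case: insubP => [j' _ _|_]; last by rewrite coef0.
    move/rowP/(_ j'): hu; rewrite !mxE coef_sum => hu; rewrite -[RHS]hu.
    apply: eq_bigr => i _; rewrite !mxE coefCM; congr (_ * _); exact/esym/horner_coef0.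
  have [h hh] := ev0_eq0 hE0.
  apply/rowP => r; rewrite mxE -hu'.
  apply: (@cyclic_decomp_free_mod _ F G m p e 0 u' h he _ r) => //; last exact: hp.
  exists (\sum_(i < m) (u' i)%:P%:P * a i), 0.
  rewrite expr0 expr1 mul1r mul0r addr0 -hh mulmx_sum_row linear_sum -sumrB mulr_suml.
  apply: eq_bigr => i _; rewrite linearZ /= rowK mxE hu' {1}(hv i) -mul_polyC; ring.
have : 'X^(m * n) %| 'X^(\sum_(r < m) p r) * \det E.
  have := det_mulmx (diag_mx (\row_i 'X^(p i))) E.
  rewrite det_diag; under eq_bigr => i _ do rewrite mxE.
  rewrite prodrXr => <-.
  have -> : diag_mx (\row_i 'X^(p i)) *m E = (\matrix_i w i) *m (\matrix_i g i).
    apply/row_matrixP => i; rewrite row_mul row_diag_mx mxE -scalemxAl -rowE rowK hw.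
    by rewrite row_mul rowK.
  rewrite det_mulmx dvdp_mull // det_bihomog // => i j l hjl.
  have [_ /(_ j l)] := hg i; rewrite addnC coef_rVpoly_ord mxE.
  by apply; lia.
rewrite Gauss_dvdpl; first by rewrite dvdp_Pexp2l // size_polyX.
by rewrite coprimep_expl // coprimep_sym coprimepX.
Qed.

End MonicDivision.

(** * Constraints on the Jordan type of a complete intersection *)

Section CompleteIntersectionType.

Variable K : fieldType.
Local Notation B := {poly {poly K}}.
Implicit Types (F G h : B) (D E : nat).

Lemma cyclic_decomp_ideal F G F' G' s p e :
  (forall h, ideal2 F G h <-> ideal2 F' G' h) ->
  cyclic_decomp F G s p e -> cyclic_decomp F' G' s p e.
Proof.
move=> hI [hspan hfree]; split=> [h|q]; last by rewrite -hI.
by have [q hq] := hspan h; exists q; apply/hI.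
Qed.

Lemma ev0_bihomog D h : bihomog D h -> ev0 h = h`_D`_0 *: 'X^D.
Proof.
move=> hD; apply/polyP => i; rewrite coef_ev0 coefZ coefXn.
by case: eqVneq => [->|hi]; rewrite ?mulr1 // mulr0 hD //; lia.
Qed.

(** Here t is the degree of G in x. The other terms have smaller degree in x, hence larger degree in
    y, so n - t is the exact power of y dividing G. *)
Lemma bihomog_leading n G : bihomog n G -> G != 0 ->
  exists t c h, [/\ (t <= n)%N, c != 0 &
    c%:P%:P * G = 'X%:P ^+ (n - t) * 'X^t - 'X%:P ^+ (n - t).+1 * h].
Proof.
move=> hG G0; case szG: (size G) => [|t]; first by case/eqP: G0; apply/eqP; rewrite -size_poly_eq0 szG.
have htn : (t <= n)%N by rewrite -ltnS -szG bihomog_size.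
have Gt0 : G`_t != 0.
  by have : lead_coef G != 0 by [rewrite lead_coef_eq0]; rewrite /lead_coef szG.
have Gt := bihomog_coef htn hG; set c := (G`_t)`_(n - t) in Gt.
have c0 : c != 0 by apply: contraNneq Gt0 => c0; rewrite Gt c0 scale0r.
exists t, c^-1, (\poly_(i < t) (- (c^-1 * (G`_i)`_(n - i)) *: 'X^(n - i - (n - t).+1))).
split; rewrite ?invr_eq0 //; apply/polyP => i.
rewrite coefB coefCM -!polyC_exp !coefCM coefXn coef_poly.
case: (ltngtP i t) => hi.
- rewrite mulr0 sub0r -scalerAr -exprD scaleNr opprK (bihomog_coef _ hG); last lia.
  by rewrite mul_polyC scalerA coefZ coefXn eqxx mulr1; congr (_ *: 'X^_); lia.
- by rewrite !mulr0 subr0 nth_default ?mulr0 // szG.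
- by rewrite hi mulr1 mulr0 subr0 Gt mul_polyC scalerA mulVf // scale1r.
Qed.

Lemma monic_CI_type F G m n s p e :
  F \is monic -> bihomog m F -> size F = m.+1 -> bihomog n G -> ev0 G = 0 ->
  cyclic_decomp F G s p e -> (forall r, (r < s)%N -> (0 < p r)%N) ->
  exists n' t, [/\ (s * n' <= \sum_(r < s) p r)%N, (t <= n')%N &
     (t < s)%N -> ~ (forall r, (r <= t)%N -> (n' - t < p r)%N)].
Proof.
move=> Fm hF szF hG G0 he hp.
have ev0F : ev0 F = 'X^m.
  rewrite (ev0_bihomog hF); move/monicP: Fm; rewrite /lead_coef szF /= => ->.
  by rewrite coefC eqxx scale1r.
(* If s > m, then x^m being F modulo y allows at most m positive parts. Conversely the ideal at y =
   0 is generated by x^m, whence m <= s. *)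
have sm : s = m.
  apply/eqP; rewrite eqn_leq; apply/andP; split.
    rewrite leqNgt; apply/negP => hms.
    have e0 : ev0 (F - 'X^m) = 0 by rewrite ev0B /= ev0F rmorphXn /= ev0X subrr.
    have [h hh] := ev0_eq0 e0.
    apply: (@cyclic_decomp_part_le _ F G s p e 0 m (- h) he) => //.
      by rewrite expr0 expr1 mul1r mulrN opprK -hh addrC subrK; apply: ideal2_gen1.
    by move=> r hr; apply: hp; lia.
  rewrite -[m]/(m.+1.-1) -(size_polyXn K m).
  apply: (cyclic_decomp_size_ge he); last by rewrite expf_neq0 ?polyX_eq0.
  by move=> h [a [b ->]]; rewrite rmorphD !rmorphM /= G0 mulr0 addr0 ev0F dvdp_mull.
subst s; have [Gz|Gn0] := eqVneq G 0.
  case: m hF szF ev0F he hp => [|m] hF szF ev0F he hp; first by exists 0, 0.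
  (* The zero form has every degree, so a degree too large for the dimension bound can be chosen. *)
  have hG' : bihomog (\sum_(r < m.+1) p r).+1 G by move=> i j _; rewrite Gz !coef0.
  have := cyclic_decomp_dim_ge Fm hF szF hG' he hp; nia.
have [t [c [h [htn c0 hh]]]] := bihomog_leading hG Gn0.
exists n, t; split=> //; first exact: cyclic_decomp_dim_ge hG he hp.
move=> hts; apply: (cyclic_decomp_part_le (h := h) he _ hts).
by rewrite -hh; apply/ideal2M/ideal2_gen2.
Qed.

(** A generator containing a pure power of x is scaled to be monic, the one of smaller degree being
    taken if both qualify. Subtracting a multiple of it from the other removes the pure power there,
    which reduces to [monic_CI_type]. *)
Lemma CI_type F G m n s p e :
  bihomog m F -> bihomog n G ->
  cyclic_decomp F G s p e -> (forall r, (r < s)%N -> (0 < p r)%N) ->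
  exists n' t, [/\ (s * n' <= \sum_(r < s) p r)%N, (t <= n')%N &
     (t < s)%N -> ~ (forall r, (r <= t)%N -> (n' - t < p r)%N)].
Proof.
wlog hmn : m n F G / G`_n`_0 != 0 -> F`_m`_0 != 0 /\ (m <= n)%N.
  move=> IH hF hG he hp.
  have he' : cyclic_decomp G F s p e.
    apply: cyclic_decomp_ideal he => h.
    by split; apply: ideal2_sub; (exact: ideal2_gen1 || exact: ideal2_gen2).
  have [c0|c0] := eqVneq (F`_m)`_0 0; have [c'0|c'0] := eqVneq (G`_n)`_0 0.
  - by apply: (IH m n F G) => //; rewrite c'0 eqxx.
  - by apply: (IH n m G F) => //; rewrite c0 eqxx.
  - by apply: (IH m n F G) => //; rewrite c'0 eqxx.
  by case: (leqP m n) => hmn; [apply: (IH m n F G) | apply: (IH n m G F)] => // _; split=> //; lia.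
move=> hF hG he hp; have [c0|c0] := eqVneq (F`_m)`_0 0.
  have c'0 : (G`_n)`_0 = 0 by apply/eqP; apply: contraT => /hmn[]; rewrite c0 eqxx.
  (* Both generators vanish at y = 0, so any polynomial in x may serve as F0; degree s + 1 already
     exceeds the bound. *)
  have := cyclic_decomp_size_ge (F0 := 'X^(s.+1)) he.
  rewrite size_polyXn ltnn => H; have {H} // : false.
  apply: H; last by rewrite expf_neq0 ?polyX_eq0.
  move=> h [a [b ->]].
  by rewrite rmorphD !rmorphM /= (ev0_bihomog hF) (ev0_bihomog hG) c0 c'0 !scale0r !mulr0 addr0 dvdp0.
set c := (F`_m)`_0 in c0; set c' := (G`_n)`_0 in hmn.
have hc'n : (c' != 0) -> (m <= n)%N by case/hmn.
have hFm : F`_m = c%:P.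
  by rewrite (bihomog_coef (leqnn m) hF) subnn expr0 alg_polyC.
pose F1 := (c^-1)%:P%:P * F; pose G1 := G - (c'%:P%:P * 'X^(n - m)) * F1.
have FE : F = c%:P%:P * F1 by rewrite /F1 mulrA -!polyCM divff // mul1r.
have hF1 : bihomog m F1 by have := bihomogM (bihomogC (c^-1)) hF.
have hF1m : F1`_m = 1 by rewrite /F1 coefCM hFm -polyCM mulVf.
have szF1 : size F1 = m.+1.
  apply/eqP; rewrite eqn_leq bihomog_size //= ltnNge.
  by apply/negP => /leq_sizeP/(_ m (leqnn m))/eqP; rewrite hF1m oner_eq0.
have F1m : F1 \is monic by apply/monicP; rewrite /lead_coef szF1.
have [c'0|c'0] := eqVneq c' 0.
  apply: (monic_CI_type F1m hF1 szF1 hG _ _ hp).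
    by rewrite (ev0_bihomog hG) -/c' c'0 scale0r.
  apply: cyclic_decomp_ideal he => h; split; apply: ideal2_sub; try exact: ideal2_gen2.
    by rewrite FE; apply/ideal2M/ideal2_gen1.
  exact/ideal2M/ideal2_gen1.
have hmn' := hc'n c'0.
have hG1 : bihomog n G1.
  apply/bihomogD/bihomogN => //.
  have := bihomogM (bihomogM (bihomogC c') (bihomogXn (n := n - m) (bihomogX K))) hF1.
  by congr bihomog; lia.
apply: (monic_CI_type F1m hF1 szF1 hG1 _ _ hp).
  rewrite (ev0_bihomog hG1) /G1 coefB -mulrA coefCM coefXnM coefB coefCM -/c' ltnNge leq_subr /=.
  by rewrite subKn // hF1m coefC eqxx mulr1 subrr scale0r.
apply: cyclic_decomp_ideal he => h; split; apply: ideal2_sub; try exact: ideal2_gen2.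
- by rewrite FE; apply/ideal2M/ideal2_gen1.
- rewrite (_ : G = G1 + (c'%:P%:P * 'X^(n - m)) * F1); last by rewrite subrK.
  by apply: ideal2D; [apply: ideal2_gen2 | apply/ideal2M/ideal2_gen1].
- exact/ideal2M/ideal2_gen1.
- apply: ideal2B; first exact: ideal2_gen2.
  exact/ideal2M/ideal2M/ideal2_gen1.
Qed.

End CompleteIntersectionType.

(** * A complete intersection with prescribed row ends *)

Section Triangular.

Variables (R : idomainType) (W : nat -> {poly R}) (s : nat).
Hypotheses (Wm : forall r, (r < s)%N -> W r \is monic)
           (szW : forall r, (r < s)%N -> size (W r) = r.+1).

Lemma monic_family_size (q : nat -> R) :
  (size (\sum_(r < s) (q r)%:P * W r)%R <= s)%N.
Proof.
apply: (leq_trans (size_sum _ _ _)); apply/bigmax_leqP => r _.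
by rewrite mul_polyC (leq_trans (size_scale_leq _ _)) ?szW.
Qed.

Lemma monic_family_coef (q : nat -> R) k : (k < s)%N ->
  (\sum_(r < k.+1) (q r)%:P * W r)`_k = q k.
Proof.
move=> hk; rewrite coef_sum (bigD1 ord_max) //= big1 ?addr0 => [|r hr].
  by rewrite coefCM; move/monicP: (Wm hk); rewrite /lead_coef szW // => ->; rewrite mulr1.
have hrk : (r < k)%N by move: hr (ltn_ord r); rewrite -val_eqE /=; lia.
by rewrite coefCM nth_default ?mulr0 // szW //; lia.
Qed.

Lemma monic_family_span (h : {poly R}) : (size h <= s)%N ->
  exists q : nat -> R, h = \sum_(r < s) (q r)%:P * W r.
Proof.
suff: forall k, (k <= s)%N -> forall h : {poly R}, (size h <= k)%N ->
    exists q : nat -> R, h = \sum_(r < k) (q r)%:P * W r by move/(_ s (leqnn s)); apply.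
move=> {h} k; elim: k => [|k IHk] hk h hh.
  by exists (fun=> 0); rewrite big_ord0; move: hh; rewrite size_poly_leq0 => /eqP.
have [|q hq] := IHk (ltnW hk) (h - (h`_k)%:P * W k).
  apply/leq_sizeP => i hi; rewrite coefB coefCM.
  move: hi; rewrite leq_eqVlt => /predU1P[<-|hi].
    by move/monicP: (Wm hk); rewrite /lead_coef szW // => ->; rewrite mulr1 subrr.
  by rewrite (nth_default _ (leq_trans hh hi)) [(W k)`_i]nth_default ?szW // mulr0 subr0.
exists (fun r => if r == k then h`_k else q r).
rewrite big_ord_recr /= eqxx -[LHS](subrK ((h`_k)%:P * W k)) hq; congr (_ + _).
by apply: eq_bigr => r _; rewrite ltn_eqF.
Qed.

Lemma monic_family_free (q : nat -> R) :
  \sum_(r < s) (q r)%:P * W r = 0 -> forall r, (r < s)%N -> q r = 0.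
Proof.
suff: forall k, (k <= s)%N -> \sum_(r < k) (q r)%:P * W r = 0 ->
    forall r, (r < k)%N -> q r = 0 by apply.
elim=> [//|k IHk] hk h0 r.
have qk : q k = 0 by rewrite -(monic_family_coef q hk) h0 coef0.
rewrite ltnS leq_eqVlt => /predU1P[->//|]; apply: IHk (ltnW hk) _ r.
by move: h0; rewrite big_ord_recr /= qk mul0r addr0.
Qed.

End Triangular.

Section Construction.

Variable K : fieldType.
Local Notation B := {poly {poly K}}.

(** The sum encodes an optional term: it has at most one summand when a is injective on the rows. *)
Lemma exists_cell_basis (a : nat -> nat) s :
  exists W : nat -> B, W 0 = 1 /\ forall r, (r < s)%N ->
    W r.+1 = 'X * W r +
      \sum_(i < r | a i == (a r).+1) 'X%:P ^+ (r.+1 - i) * W i.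
Proof.
elim: s => [|s [W [W0 IH]]]; first by exists (fun=> 1).
exists (fun j => if (j <= s)%N then W j else 'X * W s +
      \sum_(i < s | a i == (a s).+1) 'X%:P ^+ (s.+1 - i) * W i); split=> // r.
rewrite ltnS leq_eqVlt => /predU1P[->|hr].
  rewrite /= ltnn eqxx; congr (_ + _); apply: eq_bigr => i _.
  by rewrite (ltnW (ltn_ord i)).
rewrite /= hr orbT IH //; congr (_ + _); apply: eq_bigr => i _.
by rewrite (leq_trans (ltnW (ltn_ord i)) (ltnW hr)).
Qed.

(** The ideal (F, G) is compared with J, the sum of the multiples of F and of the K[y] y^(p r) W_r:
    [hI] gives one inclusion, and the stability of J under x ([JX]) the other. Since W_r is monic of
    degree r, the W_r form a K[y]-basis modulo F, and the decomposition can be read off J. *)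
Lemma exists_CI_cell (s n : nat) (a : nat -> nat) :
  (0 < s)%N -> (forall r, (r < s)%N -> (r < a r)%N) ->
  (forall r, (r.+1 < s)%N -> (a r.+1 <= (a r).+1)%N) ->
  perm_eq [seq a r | r <- iota 0 s] (iota n s) ->
  exists (F G : B) (e : nat -> B),
    [/\ bihomog s F, F \is monic /\ size F = s.+1, bihomog n G,
        cyclic_decomp F G s (fun r => a r - r)%N e & e 0 = 1].
Proof.
move=> s0 a_gt a_step a_perm.
have a_inj r r' : (r < s)%N -> (r' < s)%N -> a r = a r' -> r = r'.
  move=> hr hr' e; have := perm_uniq a_perm; rewrite iota_uniq => u.
  have sz : size [seq a r | r <- iota 0 s] = s by rewrite size_map size_iota.
  apply/eqP; rewrite -(nth_uniq 0 _ _ u) ?sz //.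
  by rewrite !(nth_map 0) ?size_iota // !nth_iota // !add0n e.
have a_range r : (r < s)%N -> (n <= a r < n + s)%N.
  move=> hr; rewrite -mem_iota -(perm_mem a_perm).
  by apply/mapP; exists r; rewrite ?mem_iota.
have a_surj v : (n <= v < n + s)%N -> exists2 r, (r < s)%N & a r = v.
  rewrite -mem_iota -(perm_mem a_perm) => /mapP[r]; rewrite mem_iota => hr ->.
  by exists r.
(* A row end exceeding that of row r by 1 occurs in row r + 1 or before row r: *)
(* row ends increase by at most 1, and the value a r is taken only once.       *)
have a_succ r r' : (r < s)%N -> (r' < s)%N -> a r' = (a r).+1 ->
    r' != r.+1 -> (r' < r)%N.
  move=> hr hr' e ne; rewrite ltnNge; apply/negP => hrr'.
  have low j : (r.+1 + j < s)%N -> (a (r.+1 + j)%N < a r)%N.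
    elim: j => [|j IHj] hj.
      rewrite addn0 in hj *; have := a_step r hj.
      have := @a_inj r.+1 r hj hr; have := @a_inj r.+1 r' hj hr'; lia.
    rewrite addnS in hj *; have := IHj (ltnW hj); have := a_step _ hj.
    by have := @a_inj (r.+1 + j).+1 r hj hr; lia.
  have hrr'1 : (r.+1 <= r')%N.
    by rewrite ltn_neqAle hrr' andbT; apply/eqP => er; move: e; rewrite er; lia.
  by have := low (r' - r.+1)%N; rewrite subnKC // => /(_ hr'); lia.
pose p r := (a r - r)%N.
have [W [W0 WS]] := exists_cell_basis a s.
have W_homog r : (r <= s)%N -> bihomog r (W r).
  elim/ltn_ind: r => -[|r] IHr hr; first by rewrite W0; exact: (bihomogC 1).
  rewrite WS //; apply: bihomogD; first by apply: (bihomogM (bihomogX K)); apply: IHr => //; lia.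
  elim/big_ind: _ => [i j _|x y|i _]; [by rewrite !coef0 | exact: bihomogD |].
  have := bihomogM (bihomogXn (n := r.+1 - i) (bihomogY K)) (IHr i _ _).
  by have := ltn_ord i => hi; rewrite muln1 subnK; [apply|]; lia.
have W_lead r : (r <= s)%N -> (W r)`_r = 1.
  elim: r => [|r IHr] hr; first by rewrite W0 coef1.
  rewrite WS // coefD coefXM IHr ?(ltnW hr) // coef_sum big1 ?addr0 // => i _.
  rewrite -polyC_exp coefCM nth_default ?mulr0 //.
  have hi := ltn_ord i; apply: (leq_trans (bihomog_size (W_homog _ _))); lia.
have W_size r : (r <= s)%N -> size (W r) = r.+1.
  move=> hr; apply/eqP; rewrite eqn_leq (bihomog_size (W_homog _ hr)) ltnNge.
  by apply/negP => /leq_sizeP/(_ r (leqnn r))/eqP; rewrite W_lead ?oner_eq0.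
have W_monic r : (r <= s)%N -> W r \is monic.
  by move=> hr; apply/monicP; rewrite /lead_coef W_size // W_lead.
have W_next r : (r < s)%N -> (forall i, (i < r)%N -> a i != (a r).+1) ->
    W r.+1 = 'X * W r.
  by move=> hr hi; rewrite WS // big1 ?addr0 // => i /(elimT eqP); have /eqP := hi i (ltn_ord i).
have W_back r i : (r < s)%N -> (i < r)%N -> a i = (a r).+1 ->
    W r.+1 = 'X * W r + 'X%:P ^+ (r.+1 - i) * W i.
  move=> hr hi e; rewrite WS // (big_pred1 (Ordinal hi)) // => j /=.
  rewrite -val_eqE /= -e; apply/eqP/eqP => [|->//].
  by apply: a_inj; [apply: ltn_trans (ltn_ord j) hr | apply: ltn_trans hi hr].
have [r0 hr0 ar0] : exists2 r, (r < s)%N & a r = n by apply: a_surj; lia.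
pose F := W s; pose G := 'X%:P ^+ p r0 * W r0.
(* Induction on the row end. Let t be the row with a t = a r - 1. Either r = t + 1 and W_r = x W_t
   with p r = p t, or r < t and y^(p r) W_r = y^(p t) W_(t+1) - x y^(p t) W_t. In the latter case
   W_(t+1) is F, or row t + 1 ends no later than row t, so that p (t+1) < p t. *)
have hI v r : (r < s)%N -> (a r <= v)%N -> ideal2 F G ('X%:P ^+ p r * W r).
  elim: v r => [|v IHv] r hr hv; first by have := a_gt r hr; lia.
  have hI_next t : (t < s)%N -> (a t <= v)%N ->
      ((t.+1 < s)%N -> a t.+1 != (a t).+1) -> ideal2 F G ('X%:P ^+ p t * W t.+1).
    move=> ht htv hne; have [e|hts] := eqVneq t.+1 s.
      by rewrite e; apply/ideal2M/ideal2_gen1.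
    have ht1 : (t.+1 < s)%N by lia.
    have {hne} := hne ht1; have at1 := a_step t ht1; have := a_gt t ht => at0; have := a_gt _ ht1 => at2.
    move=> hne; rewrite (_ : p t = (p t - p t.+1) + p t.+1)%N; last by rewrite /p; lia.
    by rewrite exprD -mulrA; apply/ideal2M/IHv => //; lia.
  have [e|hne] := eqVneq (a r) n.
    have -> : r = r0 by apply: a_inj; rewrite ?e.
    exact: ideal2_gen2.
  have [t ht at_] : exists2 t, (t < s)%N & a t = (a r).-1.
    by apply: a_surj; have := a_range r hr; lia.
  have at1 : a r = (a t).+1 by have := a_range r hr; have := a_range t ht; lia.
  have tI : ideal2 F G ('X%:P ^+ p t * W t) by apply: IHv => //; lia.
  have [er|hrt] := eqVneq r t.+1.
    have -> : W r = 'X * W t.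
      rewrite er; apply: W_next => // i hi; rewrite -at1; apply/eqP => hia.
      have : i = r by apply: a_inj => //; lia.
      lia.
    have -> : p r = p t by rewrite /p; lia.
    by rewrite mulrCA; apply: ideal2M.
  have hlt := a_succ t r ht hr at1 hrt.
  rewrite (_ : _ * _ = 'X%:P ^+ p t * W t.+1 - 'X * ('X%:P ^+ p t * W t)).
    apply: ideal2B; last exact: ideal2M.
    apply: hI_next => // [|hts]; first lia.
    by apply: contra hrt => /eqP hh; apply/eqP/a_inj; rewrite ?hh.
  rewrite (W_back t r) // (_ : p r = p t + (t.+1 - r))%N; first by rewrite exprD; ring.
  by have := a_gt _ ht; have := a_gt _ hr; rewrite /p; lia.
have {}hI r : (r < s)%N -> ideal2 F G ('X%:P ^+ p r * W r).
  by move=> hr; apply: (hI (a r)).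
pose J h := exists (c : B) (q : nat -> {poly K}),
  h = c * F + \sum_(r < s) ('X^(p r) * q r)%:P * W r.
have J0 : J 0.
  exists 0, (fun=> 0); rewrite mul0r add0r big1 // => r _.
  by rewrite mulr0 polyC0 mul0r.
have JD h1 h2 : J h1 -> J h2 -> J (h1 + h2).
  move=> [c1 [q1 ->]] [c2 [q2 ->]]; exists (c1 + c2), (fun r => q1 r + q2 r).
  rewrite mulrDl addrACA -big_split /=; congr (_ + _); apply: eq_bigr => r _.
  by rewrite mulrDr polyCD mulrDl.
have JC (c : {poly K}) h : J h -> J (c%:P * h).
  move=> [c1 [q1 ->]]; exists (c%:P * c1), (fun r => c * q1 r).
  rewrite mulrDr mulrA mulr_sumr; congr (_ + _); apply: eq_bigr => r _.
  by rewrite mulrA -polyCM mulrCA.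
have JN h : J h -> J (- h) by move=> /(JC (-1)); rewrite polyCN polyC1 mulN1r.
have JF c : J (c * F).
  exists c, (fun=> 0); rewrite big1 ?addr0 // => r _; by rewrite mulr0 polyC0 mul0r.
have JW r i : (r < s)%N -> (p r <= i)%N -> J ('X%:P ^+ i * W r).
  move=> hr hi; exists 0, (fun j => if j == r then 'X^(i - p r) else 0).
  rewrite mul0r add0r (bigD1 (Ordinal hr)) //= eqxx big1 ?addr0 => [|j hj].
    by rewrite -exprD subnKC // polyC_exp.
  rewrite (_ : _ == _ = false) ?mulr0 ?polyC0 ?mul0r //.
  by apply: contraNF hj => /eqP hj; apply/eqP/val_inj.
have JX h : J h -> J ('X * h).
  move=> [c [q ->]]; rewrite mulrDr mulrA; apply: (JD); first exact: JF.
  rewrite mulr_sumr; apply: (big_ind J J0 JD) => r _.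
  have -> : 'X * (('X^(p r) * q r)%:P * W r) = (q r)%:P * ('X%:P ^+ p r * ('X * W r)).
    by rewrite polyCM polyC_exp; ring.
  apply: (JC); have hr := ltn_ord r.
  (* Row ends grow by at most 1, so p (r+1) <= p r. The correction term, if any, is y^(p i) W_i
     exactly, because a i = a r + 1. *)
  have JW1 : J ('X%:P ^+ p r * W r.+1).
    have [->|hrs] := eqVneq r.+1 s; first exact: JF.
    have hr1 : (r.+1 < s)%N by lia.
    by apply: JW => //; have := a_step r hr1; rewrite /p; lia.
  have [/existsP[i /eqP hi]|/existsPn hn] := boolP [exists i : 'I_r, a i == (a r).+1].
    have hir := ltn_ord i; have his := ltn_trans hir hr.
    move/(canLR (addrK _)): (W_back r i hr hir hi) => <-.
    rewrite mulrBr; apply: (JD) => //; rewrite mulrA -exprD.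
    by apply: JN; apply: JW => //; have := a_gt _ hr; have := a_gt _ his; rewrite /p; lia.
  by rewrite -W_next // => i hi; apply: (hn (Ordinal hi)).
have JM h1 h2 : J h2 -> J (h1 * h2).
  move=> hh; elim/poly_ind: h1 => [|h1 c IH]; first by rewrite mul0r.
  rewrite mulrDl; apply: JD; last exact: JC.
  by rewrite (_ : h1 * 'X * h2 = 'X * (h1 * h2)); [apply: JX | ring].
have IJ h : ideal2 F G h -> J h.
  by move=> [c [c' ->]]; apply: JD (JF _) _; apply/JM/JW.
have Wms r : (r < s)%N -> W r \is monic by move/ltnW; apply: W_monic.
have Wss r : (r < s)%N -> size (W r) = r.+1 by move/ltnW; apply: W_size.
have Fm : F \is monic by apply: W_monic.
have Fs : size F = s.+1 by apply: W_size.
exists F, G, W; split=> //.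
- exact: W_homog.
- have := bihomogM (bihomogXn (n := p r0) (bihomogY K)) (W_homog r0 (ltnW hr0)).
  by congr bihomog; have := a_gt _ hr0; rewrite /p; lia.
split=> [h|q].
  have [c [v ->]] := monic_div h Fm Fs.
  have [|q hq] := monic_family_span Wms Wss (h := rVpoly v); first exact: size_poly.
  by exists q; rewrite -hq addrK; apply/ideal2M/ideal2_gen1.
split=> [/IJ[c [q' hq]] r hr|hq].
  suff : q r - 'X^(p r) * q' r = 0 by move/subr0_eq->; rewrite dvdp_mulr.
  apply: (monic_family_free Wms Wss (q := fun r => q r - 'X^(p r) * q' r)) hr.
  have hs : \sum_(r < s) (q r - 'X^(p r) * q' r)%:P * W r = c * F.
    rewrite -[RHS](addrK (\sum_(r < s) ('X^(p r) * q' r)%:P * W r)) -hq -sumrB.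
    by apply: eq_bigr => i _; rewrite polyCB mulrBl.
  rewrite -(poly_rV_K (monic_family_size Wss (fun r => q r - 'X^(p r) * q' r))) in hs *.
  by rewrite (monic_rem0 Fm Fs hs) linear0.
apply: ideal2_sum => r _; have /dvdpP[q' ->] := hq r (ltn_ord r).
by rewrite polyCM polyC_exp -mulrA; apply/ideal2M/hI.
Qed.

End Construction.

(** * Coordinates and quotient algebras *)

Lemma dhomog1E n (R : nzRingType) (l : {mpoly R[n]}) :
  l \is 1.-homog -> l = \sum_(i < n) l@_U_(i) *: 'X_i.
Proof.
move=> hl; apply/mpolyP => m; rewrite raddf_sum /=.
under eq_bigr => i _ do rewrite mcoeffZ mcoeffX.
have [/mdeg1P[i /eqP ->]|hm] := boolP (mdeg m == 1%N).
  rewrite (bigD1 i) //= eqxx mulr1 big1 ?addr0 // => j hj.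
  by rewrite eq_mnm1 (negbTE hj) mulr0.
rewrite (dhomog_nemf_coeff hl hm) big1 // => i _.
rewrite (_ : _ == _ = false) ?mulr0 //.
by apply: contraNF hm => /eqP <-; rewrite mdeg1.
Qed.

Lemma cancel_linear (R : comNzRingType) (a a' b x y : R) :
  a * a' = 1 -> a * (a' * (y - b * x)) + b * x = y.
Proof. by move=> aa'; rewrite mulrA aa' mul1r subrK. Qed.

Section Coordinates.

Variable K : fieldType.
Local Notation B := {poly {poly K}}.
Local Notation M := {mpoly K[2]}.

Lemma polyCC_divff (a : K) : a != 0 -> a%:P%:P * (a^-1)%:P%:P = 1 :> B.
Proof. by move=> a0; rewrite -!polyCM divff. Qed.

Lemma rmorph_bipoly_id (f : {rmorphism B -> B}) :
  f 'X = 'X -> f 'X%:P = 'X%:P -> (forall c : K, f c%:P%:P = c%:P%:P) ->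
  forall h, f h = h.
Proof.
move=> fx fy fc; elim/poly_ind => [|h c IH]; first exact: rmorph0.
rewrite rmorphD rmorphM /= IH fx; congr (_ + _).
elim/poly_ind: c => [|q c IHq]; first by rewrite polyC0 rmorph0.
by rewrite polyCD polyCM rmorphD rmorphM /= IHq fy fc.
Qed.

Lemma rmorph_mpoly_id n (f : {rmorphism {mpoly K[n]} -> {mpoly K[n]}}) :
  (forall c, f c%:MP = c%:MP) -> (forall i, f 'X_i = 'X_i) -> forall h, f h = h.
Proof.
move=> fc fX; elim/mpolyind => [|c m p _ _ IH]; first exact: rmorph0.
rewrite rmorphD /= IH -mul_mpolyC rmorphM /= fc; congr (_ * _ + _).
rewrite mpolyXE_id rmorph_prod /=; apply: eq_bigr => i _.
by rewrite rmorphXn /= fX.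
Qed.

Definition bipoly_eval (u v : M) : B -> M :=
  horner_eval u \o map_poly (horner_eval v \o map_poly (@mpolyC 2 K)).
HB.instance Definition _ u v := GRing.RMorphism.on (bipoly_eval u v).

Lemma bipoly_evalX u v : bipoly_eval u v 'X = u.
Proof. by rewrite /bipoly_eval /= map_polyX horner_evalE hornerX. Qed.

Lemma bipoly_evalC u v q : bipoly_eval u v q%:P = (map_poly (@mpolyC 2 K) q).[v].
Proof. by rewrite /bipoly_eval /= map_polyC /= horner_evalE hornerC horner_evalE. Qed.

Lemma bipoly_evalY u v : bipoly_eval u v 'X%:P = v.
Proof. by rewrite bipoly_evalC map_polyX hornerX. Qed.

Lemma bipoly_evalCC u v c : bipoly_eval u v c%:P%:P = c%:MP.
Proof. by rewrite bipoly_evalC map_polyC hornerC. Qed.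

Lemma bipoly_eval_homog u v D h : u \is 1.-homog -> v \is 1.-homog ->
  bihomog D h -> bipoly_eval u v h \is D.-homog.
Proof.
move=> hu hv hD; rewrite -[h]coefK poly_def rmorph_sum rpred_sum //= => i _.
rewrite -mul_polyC rmorphM rmorphXn /= bipoly_evalX.
rewrite -[h`_i]coefK poly_def raddf_sum rmorph_sum mulr_suml rpred_sum //= => j _.
rewrite -mul_polyC polyCM polyC_exp rmorphM rmorphXn /= bipoly_evalCC bipoly_evalY.
have [e|ne] := eqVneq (i + j)%N D; last by rewrite hD // mpolyC0 !mul0r rpred0.
rewrite -mulrA mul_mpolyC; apply: dhomogZ; rewrite -e addnC -[X in (X + _)%N]mul1n -[X in (_ + X)%N]mul1n.
by apply: dhomogM; apply: dhomogMn.
Qed.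

Lemma mmap_bihomog (t : 'I_2 -> B) D (f : M) :
  (forall i, bihomog 1 (t i)) -> f \is D.-homog ->
  bihomog D (mmap (polyC \o polyC) t f).
Proof.
move=> ht hf; rewrite /mmap big_seq; elim/big_ind: _ => [i j _|x y|m hm].
- by rewrite !coef0.
- exact: bihomogD.
rewrite -[D]add0n; apply: bihomogM; first exact: bihomogC.
have <- : mdeg m = D by move/dhomogP: hf; apply.
rewrite mdegE /mmap1; elim/big_rec2: _ => [|i x y _ hx]; first exact: (bihomogC 1).
by apply: bihomogM hx; have := bihomogXn (n := m i) (ht i); rewrite muln1.
Qed.

Lemma rmorph_mpoly_bipoly (t : 'I_2 -> B) : (forall i, bihomog 1 (t i)) ->
  exists T : {rmorphism M -> B},
    [/\ forall c, T c%:MP = c%:P%:P, forall i, T 'X_i = t i &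
      forall D f, f \is D.-homog -> bihomog D (T f)].
Proof.
move=> ht; exists (mmap (polyC \o polyC) t); split=> [c|i|D f].
- exact: mmapC.
- by rewrite /= mmapX mmap1U.
- exact: mmap_bihomog.
Qed.

Lemma rmorph_bipoly_mpoly (u v : M) : u \is 1.-homog -> v \is 1.-homog ->
  exists P : {rmorphism B -> M},
    [/\ forall c : K, P c%:P%:P = c%:MP, P 'X = u, P 'X%:P = v &
      forall D h, bihomog D h -> P h \is D.-homog].
Proof.
move=> hu hv; exists (bipoly_eval u v); split=> [c|||D h].
- exact: bipoly_evalCC.
- exact: bipoly_evalX.
- exact: bipoly_evalY.
- exact: bipoly_eval_homog.
Qed.

(** Some variable X_i occurs in l; the other variable X_j is sent to x, l to y, and X_i is solved
    from l = a X_i + b X_j. *)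
Lemma linear_coordinates (l : M) : l \is 1.-homog -> l != 0 ->
  exists (T : {rmorphism M -> B}) (P : {rmorphism B -> M}),
    [/\ cancel T P, cancel P T, P 'X%:P = l, forall c : K, P c%:P%:P = c%:MP &
      (forall D f, f \is D.-homog -> bihomog D (T f)) /\
      (forall D h, bihomog D h -> P h \is D.-homog)].
Proof.
move=> hl l0.
have [i hi] : exists i : 'I_2, l@_U_(i) != 0.
  apply/existsP; apply: contraR l0 => /existsPn h; rewrite (dhomog1E hl).
  by rewrite big1 // => i _; have /negPn/eqP -> := h i; rewrite scale0r.
have [j [ij ijP]] : exists j : 'I_2, i != j /\ forall k, k != j -> k = i.
  by exists (rev_ord i); case: i {hi} => -[|[|//]] ?; split=> // -[[|[|//]]] ? // _; apply/val_inj.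
set a := l@_U_(i) in hi; pose b := l@_U_(j).
have lE : l = a%:MP * 'X_i + b%:MP * 'X_j.
  rewrite {1}(dhomog1E hl) (bigD1 i) //= (bigD1 j) 1?eq_sym //= big1 ?addr0.
    by rewrite !mul_mpolyC.
  by move=> k /andP[hki /ijP hk]; rewrite hk eqxx in hki.
pose t k : B := if k == j then 'X else (a^-1)%:P%:P * ('X%:P - b%:P%:P * 'X).
have ht k : bihomog 1 (t k).
  rewrite /t; case: ifP => _; first exact: bihomogX.
  apply: (bihomogM (bihomogC _)); apply: bihomogD; first exact: bihomogY.
  by apply/bihomogN/(bihomogM (bihomogC _))/bihomogX.
have [T [Tc TX hT]] := rmorph_mpoly_bipoly ht.
have hX : ('X_j : M) \is 1.-homog by rewrite dhomogX /= mdeg1.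
have [P [Pc Px Py hP]] := rmorph_bipoly_mpoly hX hl.
have Tj : T 'X_j = 'X by rewrite TX /t eqxx.
have Ti : T 'X_i = (a^-1)%:P%:P * ('X%:P - b%:P%:P * 'X) by rewrite TX /t (negbTE ij).
have Tl : T l = 'X%:P.
  by rewrite lE rmorphD !rmorphM /= !Tc Tj Ti; apply/cancel_linear/polyCC_divff.
exists T, P; split=> //.
- apply: (@rmorph_mpoly_id 2 (P \o T)) => [c|k] /=; first by rewrite Tc Pc.
  have [->|/ijP->] := eqVneq k j; first by rewrite Tj.
  rewrite Ti rmorphM rmorphB rmorphM /= !Pc Py Px lE.
  by rewrite addrK mulrA -mpolyCM mulVf // mpolyC1 mul1r.
- apply: (@rmorph_bipoly_id (T \o P)) => [||c] /=; first by rewrite Px.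
    by rewrite Py.
  by rewrite Pc Tc.
Qed.

End Coordinates.

(** * Algebra structure on a finite-dimensional quotient *)

Section QuotientAlgebra.

Variables (K : fieldType) (R : comAlgType K) (N : nat).
Variables (pr : {linear R -> 'rV[K]_N}) (sec : 'rV[K]_N -> R).
Hypotheses (secK : cancel sec pr).
Hypotheses (kerM : forall a h, pr h = 0 -> pr (a * h) = 0) (pr1 : pr 1 != 0).

(** The proofs are arguments of the type because the ring instances declared on it depend on
    them. *)
Definition quot_alg of cancel sec pr & (forall a h, pr h = 0 -> pr (a * h) = 0)
  & pr 1 != 0 : Type := 'rV[K]_N.
Local Notation A := (quot_alg secK kerM pr1).

HB.instance Definition _ := Vector.copy A 'rV[K]_N.

Let proj (h : R) : A := pr h.
Let lift (u : A) : R := sec u.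
Let mul (u v : A) : A := proj (lift u * lift v).

Let liftK : cancel lift proj.
Proof. exact: secK. Qed.

Let projD a b : proj (a + b) = proj a + proj b.
Proof. exact: (linearD pr). Qed.

Let projZ c a : proj (c *: a) = c *: proj a.
Proof. by rewrite /proj linearZ. Qed.

Let projM_lift a b : proj (a * lift (proj b)) = proj (a * b).
Proof.
apply/eqP; rewrite -subr_eq0 /proj -linearB -mulrBr; apply/eqP/kerM.
by rewrite linearB /= [pr (lift _)]secK subrr.
Qed.

Let lift_projM a b : proj (lift (proj a) * b) = proj (a * b).
Proof. by rewrite mulrC projM_lift mulrC. Qed.

Let mulA : associative mul.
Proof. by move=> u v w; rewrite /mul projM_lift lift_projM mulrA. Qed.

Let mulC : commutative mul.
Proof. by move=> u v; rewrite /mul mulrC. Qed.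

Let mul1 : left_id (proj 1) mul.
Proof. by move=> u; rewrite /mul lift_projM mul1r liftK. Qed.

Let mulD : left_distributive mul +%R.
Proof.
move=> u v w; rewrite -[u in LHS]liftK -[v in LHS]liftK /mul.
by rewrite -projD lift_projM mulrDl projD.
Qed.

HB.instance Definition _ :=
  GRing.Zmodule_isComNzRing.Build A mulA mulC mul1 mulD pr1.

Let scaleAl (c : K) (u v : A) : c *: (u * v) = (c *: u) * v.
Proof.
rewrite -[LHS]/(c *: mul u v) -[RHS]/(mul (c *: u) v) -[u in RHS]liftK.
by rewrite -[c *: proj _]projZ /mul lift_projM -scalerAl projZ.
Qed.

HB.instance Definition _ := GRing.Lmodule_isLalgebra.Build K A scaleAl.
HB.instance Definition _ := GRing.Lalgebra_isComAlgebra.Build K A.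
HB.instance Definition _ := Algebra_isFalgebra.Build K A.

Definition quot_proj (h : R) : A := pr h.

Let quot_proj_linear : linear quot_proj.
Proof. by move=> c u v; apply: linearP. Qed.

HB.instance Definition _ := GRing.isLinear.Build K R A _ quot_proj quot_proj_linear.

Let quot_proj_monoid : monoid_morphism quot_proj.
Proof.
by split=> // u v; apply/esym; rewrite -[RHS]projM_lift -[RHS]lift_projM.
Qed.

HB.instance Definition _ := GRing.isMonoidMorphism.Build R A quot_proj quot_proj_monoid.

Lemma quot_algP : exists (B : falgType K) (phi : {lrmorphism R -> B}),
  (forall b, exists h, phi h = b) /\ (forall h, phi h = 0 <-> pr h = 0).
Proof.
by exists A, quot_proj; split=> // b; exists (sec b); apply: secK.
Qed.

End QuotientAlgebra.

Section IdealQuotient.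

Variable K : fieldType.
Local Notation M := {mpoly K[2]}.

(** Coordinates modulo the ideal are unique by freeness, so the chosen coordinate function is
    linear, and its kernel is the ideal. *)
Lemma exists_ideal_quotient (f g : M) N (b : 'I_N -> M) :
  (forall h, exists c : 'I_N -> K, ideal2 f g (h - \sum_i c i *: b i)) ->
  (forall c : 'I_N -> K, ideal2 f g (\sum_i c i *: b i) -> forall i, c i = 0) ->
  ~ ideal2 f g 1 ->
  exists (A : falgType K) (phi : {lrmorphism M -> A}),
    (forall a, exists h, phi h = a) /\ (forall h, phi h = 0 <-> ideal2 f g h).
Proof.
move=> hspan hfree h1; have [co hco] := functional_choice _ hspan.
have co_uniq h (c : 'I_N -> K) : ideal2 f g (h - \sum_i c i *: b i) -> forall i, co h i = c i.
  move=> hc i; apply/eqP; rewrite -subr_eq0; apply/eqP.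
  apply: (hfree (fun i => co h i - c i)) => {i}.
  rewrite (_ : \sum_i _ = (h - \sum_i c i *: b i) - (h - \sum_i co h i *: b i)).
    exact: ideal2B.
  rewrite opprB addrC addrA subrK -sumrB; apply: eq_bigr => i _; exact: scalerBl.
pose pr h : 'rV[K]_N := \row_i co h i.
pose sec (u : 'rV[K]_N) := \sum_i u 0 i *: b i.
have pr_lin : linear pr.
  move=> a u v; apply/rowP => i; rewrite !mxE.
  apply: (co_uniq _ (fun i => a * co u i + co v i)).
  rewrite (_ : _ - _ = a%:MP * (u - \sum_i co u i *: b i) + (v - \sum_i co v i *: b i)).
    by apply: ideal2D; first apply: ideal2M.
  rewrite mul_mpolyC scalerBr addrACA -opprD scaler_sumr -big_split /=.
  by congr (_ - _); apply: eq_bigr => j _; rewrite scalerDl scalerA.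
have secK : cancel sec pr.
  move=> u; apply/rowP => i; rewrite mxE; apply: (co_uniq _ (fun i => u 0 i)).
  by rewrite subrr; apply: ideal2_0.
have pr0 h : pr h = 0 <-> ideal2 f g h.
  split=> [h0|hI].
    have := hco h; rewrite big1 ?subr0 // => i _.
    by move/rowP/(_ i): h0; rewrite !mxE => ->; rewrite scale0r.
  apply/rowP => i; rewrite !mxE; apply: (co_uniq _ (fun=> 0)).
  by rewrite big1 ?subr0 // => j _; rewrite scale0r.
pose prL : {linear M -> 'rV[K]_N} :=
  HB.pack pr (GRing.isLinear.Build K M 'rV[K]_N _ pr pr_lin).
have kerM a h : prL h = 0 -> prL (a * h) = 0.
  by move=> /pr0 hI; apply/pr0/ideal2M.
have pr1 : prL 1 != 0 by apply/eqP => /pr0.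
have [A [phi [hs hk]]] := quot_algP (pr := prL) secK kerM pr1.
by exists A, phi; split=> // h; rewrite hk; apply: pr0.
Qed.

End IdealQuotient.

(** * Jordan bases *)

Import tagnat.

Lemma sum_tagnat (V : nmodType) n (p : 'I_n -> nat) (f : nat -> nat -> V) :
  \sum_(k < (\sum_i p i)%N) f (sig1 k) (sig2 k) = \sum_i \sum_(j < p i) f i j.
Proof.
rewrite sig_big_dep /= (reindex _ sig_bij_on) /=.
by apply: eq_bigr => k _.
Qed.

Section CyclicBasis.

Variables (K : fieldType) (s : nat) (p : nat -> nat).
Local Notation B := {poly {poly K}}.
Implicit Types (F G h : B) (e : nat -> B).
Local Notation idx := 'I_(\sum_(i < s) p i).

Definition cyclic_basis e (k : idx) : B := 'X%:P ^+ sig2 k * e (sig1 k).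

Definition ord_fun (V : nmodType) n (f : 'I_n -> V) (i : nat) : V :=
  if insub i is Some j then f j else 0.

Lemma ord_funE (V : nmodType) n (f : 'I_n -> V) (i : 'I_n) : ord_fun f i = f i.
Proof. by rewrite /ord_fun valK. Qed.

Definition row_poly (c : idx -> K) (r : nat) : {poly K} :=
  ord_fun (fun i : 'I_s => \sum_(j < p i) c (Rank i j) *: 'X^j) r.

Lemma coef_row_poly (c : idx -> K) (k : idx) : (row_poly c (sig1 k))`_(sig2 k) = c k.
Proof.
rewrite /row_poly ord_funE coef_sum (bigD1 (sig2 k)) //= coefZ coefXn eqxx mulr1.
rewrite sig2K big1 ?addr0 // => j hj; rewrite coefZ coefXn.
by rewrite (_ : _ == _ = false) ?mulr0 // eq_sym; apply: contraNF hj => /eqP/val_inj->.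
Qed.

Lemma size_row_poly (c : idx -> K) r : (r < s)%N -> (size (row_poly c r) <= p r)%N.
Proof.
move=> hr; rewrite /row_poly -[r]/(nat_of_ord (Ordinal hr)) ord_funE.
apply: (leq_trans (size_sum _ _ _)); apply/bigmax_leqP => j _.
by apply: (leq_trans (size_scale_leq _ _)); rewrite size_polyXn ltn_ord.
Qed.

Lemma sum_cyclic_basis (q : nat -> {poly K}) e :
  (forall r, (r < s)%N -> (size (q r) <= p r)%N) ->
  \sum_k ((q (sig1 k))`_(sig2 k))%:P%:P * cyclic_basis e k =
  \sum_(r < s) (q r)%:P * e r.
Proof.
move=> hq; rewrite /cyclic_basis.
rewrite (sum_tagnat (fun i : 'I_s => p i) (fun r c => ((q r)`_c)%:P%:P * ('X%:P ^+ c * e r))).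
apply: eq_bigr => r _; under eq_bigr => j _ do rewrite mulrA -polyC_exp -polyCM [_%:P * 'X^_]mul_polyC.
rewrite -mulr_suml -rmorph_sum /=; congr (_%:P * _).
rewrite -{2}[q r]coefK poly_def [RHS](big_ord_widen (p r) (fun i => (q r)`_i *: 'X^i)) ?hq //.
rewrite [RHS]big_mkcond; apply: eq_bigr => j _; case: ltnP => // hj.
by rewrite nth_default ?scale0r.
Qed.

Lemma sum_row_poly (c : idx -> K) e :
  \sum_k (c k)%:P%:P * cyclic_basis e k = \sum_(r < s) (row_poly c r)%:P * e r.
Proof.
rewrite -(sum_cyclic_basis e (size_row_poly c)).
by apply: eq_bigr => k _; rewrite coef_row_poly.
Qed.

(** Translation from K[y]-coefficients to K-coordinates: once y^(p r) [e r] is in the ideal, each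
    coefficient [q r] may be truncated below degree [p r]. *)
Lemma cyclic_decompP F G e :
  cyclic_decomp F G s p e <->
  [/\ forall h, exists c : idx -> K,
        ideal2 F G (h - \sum_k (c k)%:P%:P * cyclic_basis e k),
      forall c : idx -> K, ideal2 F G (\sum_k (c k)%:P%:P * cyclic_basis e k) ->
        forall k, c k = 0 &
      forall r, (r < s)%N -> ideal2 F G ('X%:P ^+ p r * e r)].
Proof.
have trunc (q : nat -> {poly K}) : (forall r, (r < s)%N -> ideal2 F G ('X%:P ^+ p r * e r)) ->
    ideal2 F G (\sum_(r < s) (q r)%:P * e r -
      \sum_k ((q (sig1 k))`_(sig2 k))%:P%:P * cyclic_basis e k).
  move=> hp.
  rewrite (eq_bigr (fun k : idx => ((take_poly (p (sig1 k)) (q (sig1 k)))`_(sig2 k))%:P%:P *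
      cyclic_basis e k)); last by move=> k _; rewrite coef_take_poly ltn_ord.
  rewrite (sum_cyclic_basis (q := fun r => take_poly (p r) (q r))); last first.
    by move=> r _; apply: size_take_poly.
  rewrite -sumrB; apply: ideal2_sum => r _.
  rewrite -mulrBl -polyCB -{1}[q r](poly_take_drop (p r)) addrAC subrr add0r.
  by rewrite polyCM polyC_exp -mulrA; apply/ideal2M/hp.
split=> [[hspan hfree]|[hspan hfree hp]].
  have hp r : (r < s)%N -> ideal2 F G ('X%:P ^+ p r * e r).
    move=> hr; have [_] := hfree (fun i => if i == r then 'X^(p r) else 0).
    rewrite (bigD1 (Ordinal hr)) //= eqxx polyC_exp big1 ?addr0 => [|i hi]; last first.
      rewrite (_ : _ == _ = false) ?polyC0 ?mul0r //.
      by apply: contraNF hi => /eqP hi; apply/eqP/val_inj.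
    by apply=> i _; case: eqP => [->|_]; rewrite ?dvdpp ?dvdp0.
  split=> // [h|c].
    have [q hq] := hspan h; exists (fun k => (q (sig1 k))`_(sig2 k)).
    by have := ideal2D hq (trunc q hp); rewrite addrA subrK.
  rewrite sum_row_poly => /hfree hc k.
  rewrite -(coef_row_poly c k); have := hc _ (ltn_ord (sig1 k)).
  have := size_row_poly c (ltn_ord (sig1 k)).
  move: (row_poly c _) => q hq hd.
  suff -> : q = 0 by rewrite coef0.
  apply/eqP; apply: contraT => q0; have := dvdp_leq q0 hd.
  by rewrite size_polyXn ltnNge hq.
split=> [h|q].
  by have [c hc] := hspan h; exists (row_poly c); rewrite -sum_row_poly.
split=> [hq r hr|hd].
  have := ideal2B hq (trunc q hp); rewrite opprB addrC subrK => /hfree hz.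
  rewrite -[q r](poly_take_drop (p r)); apply: dvdp_add; last exact: dvdp_mull.
  rewrite (_ : take_poly _ _ = 0) ?dvdp0 //.
  apply/polyP => j; rewrite coef_take_poly coef0; case: ifP => // hj.
  have := hz (Rank (Ordinal hr) (Ordinal hj)).
  by rewrite Rank2K /= Rank1K.
apply: ideal2_sum => r _; have /dvdpP[q' ->] := hd r (ltn_ord r).
by rewrite polyCM polyC_exp -mulrA; apply/ideal2M/hp.
Qed.

End CyclicBasis.

Section Transport.

Variables (R S : comNzRingType) (T : {rmorphism R -> S}) (P : {rmorphism S -> R}).
Hypotheses (TK : cancel T P) (PK : cancel P T).

Lemma ideal2_rmorph f g h : ideal2 f g h -> ideal2 (T f) (T g) (T h).
Proof. by move=> [a [b ->]]; exists (T a), (T b); rewrite rmorphD !rmorphM. Qed.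

Lemma regular_pair_iso f g : regular_pair f g -> regular_pair (T f) (T g).
Proof.
move=> [h1 h2 h3]; split=> [h fh|h [a ha]|[a [b hab]]].
- by rewrite -[h]PK (h1 (P h)) ?rmorph0 // -[f]TK -rmorphM fh rmorph0.
- have [|b hb] := h2 (P h).
    by exists (P a); rewrite -[g]TK -[f in RHS]TK -!rmorphM ha.
  by exists (T b); rewrite -rmorphM -hb PK.
- apply: h3; exists (P a), (P b).
  by rewrite -[f]TK -[g in RHS]TK -!rmorphM -rmorphD -hab rmorph1.
Qed.

End Transport.

Lemma ideal2_iso (R S : comNzRingType) (T : {rmorphism R -> S}) (P : {rmorphism S -> R})
    f g h : cancel T P -> ideal2 f g h <-> ideal2 (T f) (T g) (T h).
Proof.
move=> TK; split; first exact: ideal2_rmorph.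
by move=> /(ideal2_rmorph P); rewrite !TK.
Qed.

Section Regular.

Variables (K : fieldType) (F G : {poly {poly K}}) (s : nat) (p : nat -> nat).
Variable e : nat -> {poly {poly K}}.
Hypotheses (Fm : F \is monic) (szF : size F = s.+1) (he : cyclic_decomp F G s p e).
Hypotheses (s0 : (0 < s)%N) (e0 : e 0 = 1) (p0 : (0 < p 0)%N).

Lemma cyclic_decomp_ideal2C (q : {poly K}) : ideal2 F G q%:P <-> 'X^(p 0) %| q.
Proof.
have -> : q%:P = \sum_(r < s) (if r == 0%N :> nat then q else 0)%:P * e r.
  rewrite (bigD1 (Ordinal s0)) //= e0 mulr1 big1 ?addr0 // => r hr.
  rewrite (_ : _ == _ = false) ?polyC0 ?mul0r //.
  by apply: contraNF hr => /eqP hr; apply/eqP/val_inj.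
rewrite (he.2 (fun r => if r == 0%N then q else 0)).
split=> [/(_ 0 s0) //|hq r _]; case: eqP => [->//|_]; exact: dvdp0.
Qed.

(** Since e 0 = 1, the ideal contains y^(p 0). If F divides G h, it therefore divides y^(p 0) h,
    hence h, because y is a nonzerodivisor modulo the monic F. *)
Lemma cyclic_decomp_regular : regular_pair F G.
Proof.
split=> [h /eqP|h [a ha]|].
- by rewrite mulf_eq0 (negbTE (monic_neq0 Fm)) => /eqP.
- have [c [c' hc]] := (cyclic_decomp_ideal2C _).2 (dvdpp 'X^(p 0)).
  have [b [v hv]] := monic_div h Fm szF; exists b; rewrite hv.
  suff -> : v = 0 by rewrite linear0 addr0.
  suff vX : 'X^(p 0) *: v = 0.
    apply/rowP => i; move/rowP/(_ i): vX; rewrite !mxE => /eqP.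
    by rewrite mulf_eq0 expf_eq0 polyX_eq0 andbF => /eqP.
  apply: (monic_rem0 (c := c * h + c' * a - ('X^(p 0))%:P * b) Fm szF).
  rewrite linearZ /= -mul_polyC.
  have -> : rVpoly v = h - b * F by rewrite hv addrAC subrr add0r.
  have -> : ('X^(p 0))%:P * (h - b * F) = ('X^(p 0))%:P * h - ('X^(p 0))%:P * b * F by ring.
  by rewrite {1}hc mulrDl -[c' * G * h]mulrA ha; ring.
- rewrite -polyC1 cyclic_decomp_ideal2C => /(dvdp_leq (oner_neq0 _)).
  by rewrite size_polyXn size_poly1; lia.
Qed.

End Regular.

Section Jordan.

Variables (K : fieldType) (P : seq nat).
Local Notation idx := 'I_(\sum_(i < size P) nth 0%N P i).

Lemma jordan_mxE (k l : idx) :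
  jordan_mx K P k l = ((sig1 k == sig1 l) && ((sig2 k).+1 == sig2 l :> nat))%:R.
Proof.
rewrite /jordan_mx /mxdiag /mxblock mxE; move: (sig2 k) (sig2 l).
have [<-|hkl] := eqVneq (sig1 k) (sig1 l) => i j; last by rewrite mxE.
by rewrite conform_mx_id mxE.
Qed.

Lemma sum_jordan_mx (V : lmodType K) (v : idx -> V) (r : 'I_(size P)) (j : 'I_(nth 0%N P r)) :
  \sum_l jordan_mx K P (Rank r j) l *: v l =
    if insub j.+1 is Some j' then v (Rank r j') else 0.
Proof.
have jE l : jordan_mx K P (Rank r j) l = ((r == sig1 l) && (j.+1 == sig2 l :> nat))%:R.
  by rewrite jordan_mxE Rank2K /= Rank1K.
case: insubP => [j' hj jj'|hj].
  rewrite (bigD1 (Rank r j')) //= jE Rank2K /= Rank1K eqxx jj' eqxx scale1r big1 ?addr0 // => l hl.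
  rewrite jE (_ : _ && _ = false) ?scale0r //; apply: contraNF hl => /andP[/eqP e1 /eqP e2].
  rewrite -[l]sig2K -val_eqE /= eq_Rank -e2 jj' eqxx andbT; exact/eqP/esym.
rewrite big1 // => l _; rewrite jE (_ : _ && _ = false) ?scale0r //.
apply: contraNF hj => /andP[/eqP e1 /eqP ->].
by rewrite (leq_trans (ltn_ord (sig2 l))) // -e1.
Qed.

(** The first vector of each block generates the block under f; its lift will be the generator
    [e r]. *)
Lemma jordan_basis_iter (V : vectType K) (f : 'End(V)) (v : idx -> V) :
  (forall r : 'I_(size P), (0 < nth 0%N P r)%N) ->
  (forall k, f (v k) = \sum_l jordan_mx K P k l *: v l) ->
  exists w : 'I_(size P) -> V,
    (forall k, v k = iter (sig2 k) f (w (sig1 k))) /\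
    (forall r : 'I_(size P), iter (nth 0%N P r) f (w r) = 0).
Proof.
move=> hP hf; exists (fun r => v (Rank r (Ordinal (hP r)))).
have main (r : 'I_(size P)) j (hj : (j < nth 0%N P r)%N) :
    iter j f (v (Rank r (Ordinal (hP r)))) = v (Rank r (Ordinal hj)).
  elim: j hj => [|j IHj] hj /=; first by congr (v (Rank _ _)); apply: val_inj.
  by rewrite (IHj (ltnW hj)) hf sum_jordan_mx insubT.
split=> [k|r].
  rewrite (main (sig1 k) (sig2 k) (ltn_ord _)) -[in LHS](sig2K k).
  by congr (v (Rank _ _)); apply: val_inj.
have hj : ((nth 0%N P r).-1 < nth 0%N P r)%N by rewrite prednK.
rewrite -[X in iter X](prednK (hP r)) /= (main r _ hj) hf sum_jordan_mx /=.
by rewrite insubF // prednK ?ltnn.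
Qed.

Lemma iter_jordan_basis (V : vectType K) (f : 'End(V)) (w : 'I_(size P) -> V) k :
  (forall r : 'I_(size P), iter (nth 0%N P r) f (w r) = 0) ->
  f (iter (sig2 k) f (w (sig1 k))) =
    \sum_l jordan_mx K P k l *: iter (sig2 l) f (w (sig1 l)).
Proof.
move=> hw; rewrite -[k in RHS]sig2K sum_jordan_mx.
case: insubP => [j' hj jj'|hj]; first by rewrite Rank2K /= Rank1K jj'.
have e : (sig2 k).+1 = nth 0%N P (sig1 k) by have := ltn_ord (sig2 k); lia.
by rewrite -iterS e hw.
Qed.

End Jordan.

Lemma iter_amull (K : fieldType) (A : falgType K) (a b : A) n :
  iter n (amull a) b = a ^+ n * b.
Proof.
by elim: n => [|n IHn] /=; rewrite ?mul1r // IHn lfunE /= exprS mulrA.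
Qed.

Lemma CIJT_cyclic_decomp (K : fieldType) (p : seq nat) :
  CIJT K p -> exists (F G : {poly {poly K}}) e m n,
    [/\ bihomog m F, bihomog n G & cyclic_decomp F G (size p) (nth 0%N p) e].
Proof.
move=> [A [phi [l [[phi_surj [f [g [m [n [hf hg _ phi_ker]]]]]] hl l0 [hp [b [hb hbJ]]]]]]].
have [T [P [TK PK Py Pc [hT _]]]] := linear_coordinates hl l0.
have ker h : phi (P h) = 0 <-> ideal2 (T f) (T g) h.
  by rewrite phi_ker (ideal2_iso _ _ _ TK) PK.
have [|w [bw w0]] := jordan_basis_iter _ hbJ.
  by move=> r; apply: partition_nth_gt0.
have /fin_all_exists[e' he'] : forall r, exists h, phi (P h) = w r.
  by move=> r; have [h hh] := phi_surj (w r); exists (T h); rewrite TK.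
pose e := ord_fun e'.
have phiY i h : phi (P ('X%:P ^+ i * h)) = iter i (amull (phi l)) (phi (P h)).
  by rewrite iter_amull !rmorphM !rmorphXn /= Py.
have phiE k : phi (P (cyclic_basis e k)) = tnth b k.
  by rewrite phiY /e ord_funE he' -bw.
have phi_sum (c : 'I_(\sum_(i < size p) nth 0%N p i) -> K) :
    phi (P (\sum_k (c k)%:P%:P * cyclic_basis e k)) = \sum_k c k *: tnth b k.
  rewrite !rmorph_sum /=; apply: eq_bigr => k _.
  by rewrite rmorphM /= Pc mul_mpolyC linearZ /= phiE.
exists (T f), (T g), e, m, n; split; [exact: hT | exact: hT |].
apply/cyclic_decompP; split=> [h|c|r hr].
- exists (fun k => coord b k (phi (P h))); apply/ker.
  rewrite !rmorphB /= phi_sum.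
  rewrite {1}(coord_basis hb (memvf (phi (P h)))).
  by apply/eqP; rewrite subr_eq0; apply/eqP; apply: eq_bigr => k _; rewrite (tnth_nth 0).
- move/ker; rewrite phi_sum => h0 k; have /freeP := basis_free hb; apply.
  by rewrite -[RHS]h0; apply: eq_bigr => i _; rewrite (tnth_nth 0).
- apply/ker; rewrite phiY /e -[r]/(nat_of_ord (Ordinal hr)) ord_funE he'; exact: w0.
Qed.

Lemma cyclic_decomp_CIJT (K : fieldType) (p : seq nat) (F G : {poly {poly K}}) e n :
  is_partition p -> (0 < size p)%N ->
  bihomog (size p) F -> F \is monic -> size F = (size p).+1 -> bihomog n G ->
  cyclic_decomp F G (size p) (nth 0%N p) e -> e 0 = 1 -> CIJT K p.
Proof.
move=> hp s0 hF Fm szF hG he e0.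
pose l : {mpoly K[2]} := 'X_ord0.
have hl : l \is 1.-homog by rewrite dhomogX /= mdeg1.
have l0 : l != 0 by rewrite -msize_poly_eq0 msizeX.
have [T [P [TK PK Py Pc [_ hP]]]] := linear_coordinates hl l0.
have reg := cyclic_decomp_regular Fm szF he s0 e0 (partition_nth_gt0 hp s0).
have regP := regular_pair_iso PK TK reg.
have /cyclic_decompP[hspan hfree hpe] := he.
pose b (k : 'I_(\sum_(i < size p) nth 0%N p i)) : {mpoly K[2]} := P (cyclic_basis e k).
have sumE (c : 'I_(\sum_(i < size p) nth 0%N p i) -> K) :
    \sum_k c k *: b k = P (\sum_k (c k)%:P%:P * cyclic_basis e k).
  by rewrite rmorph_sum; apply: eq_bigr => k _; rewrite rmorphM /= Pc mul_mpolyC.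
have bspan h : exists c, ideal2 (P F) (P G) (h - \sum_k c k *: b k).
  have [c hc] := hspan (T h); exists c; rewrite sumE -[h]TK -rmorphB.
  exact: ideal2_rmorph.
have bfree c : ideal2 (P F) (P G) (\sum_k c k *: b k) -> forall k, c k = 0.
  by rewrite sumE => /(ideal2_iso _ _ _ PK); apply: hfree.
have [_ _ h1] := regP.
have [A [phi [phi_surj phi_ker]]] := exists_ideal_quotient bspan bfree h1.
exists A, phi, l; split=> //.
  split=> //; exists (P F), (P G), (size p), n; split=> //; exact: hP.
split=> //; exists [tuple phi (b k) | k < _]; split.
  have phi_sum (c : 'I_(\sum_(i < size p) nth 0%N p i) -> K) :
      phi (\sum_k c k *: b k) = \sum_k c k *: phi (b k).
    by rewrite linear_sum; apply: eq_bigr => k _; rewrite linearZ.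
  apply/andP; split.
    rewrite eqEsubv subvf; apply/subvP => a _; have [h <-] := phi_surj a.
    have [c /phi_ker/eqP] := bspan h; rewrite rmorphB /= subr_eq0 => /eqP ->.
    rewrite phi_sum; apply: memv_suml => k _; apply/memvZ/memv_span.
    by rewrite -(tnth_mktuple (fun k => phi (b k)) k) mem_tnth.
  apply/freeP => c hc; apply: bfree; apply/phi_ker; rewrite phi_sum -[RHS]hc.
  by apply: eq_bigr => k _; rewrite -tnth_nth tnth_mktuple.
move=> k.
have bE i : phi (b i) = iter (sig2 i) (amull (phi l)) (phi (P (e (sig1 i)))).
  by rewrite iter_amull /b /cyclic_basis !rmorphM !rmorphXn /= Py.
have := @iter_jordan_basis K p A (amull (phi l)) (fun r => phi (P (e r))) k.
rewrite tnth_mktuple bE => ->.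
  by apply: eq_bigr => i _; rewrite tnth_mktuple bE.
move=> r; rewrite iter_amull -Py -!rmorphXn -!rmorphM; apply/phi_ker.
by apply: ideal2_rmorph; rewrite /= polyC_exp; apply: hpe; apply: ltn_ord.
Qed.

Theorem theorem1 (K : fieldType) (d k : nat) (P : seq nat)
  (hd : (2 <= d)%N) (hk : (1 <= k)%N)
  (Kinf : infinite_type K)
  (Kchar : [pchar K] =i pred0 \/
           exists2 p : nat, p \in [pchar K] & (2 * d + k - 3 < p)%N)
  (hP : is_partition P)
  (hT : has_diag_lengths P (seqT d k)) :
  CIJT K P <-> (size P = d \/ size P = (d + k - 1)%N).
Proof.
have d0 : (0 < d)%N by lia.
have hds := size_diagT_ge d0 hk hP hT.
split=> [/CIJT_cyclic_decomp[F [G [e [m [n [hF hG he]]]]]]|hs].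
  have p_gt0 r : (r < size P)%N -> (0 < nth 0%N P r)%N by apply: partition_nth_gt0.
  have [n' [t [hn ht]]] := CI_type hF hG he p_gt0.
  case: (leqP (size P) (d + k - 1)) => [hsN _|hsN]; first exact: size_diagT hsN.
  have sumP : (\sum_(r < size P) nth 0 P r)%N = (d * (d + k - 1))%N.
    by rewrite -(sumn_diagT d0 hk hP hT) sumnE (big_nth 0%N) big_mkord.
  (* With more than N parts, s n' <= d N forces n' < d. For r <= t, the row end r + P_r is at least
     d > n', so P_r > n' - t. *)
  have hn'd : (n' < d)%N by rewrite sumP in hn; nia.
  case=> [|r hr]; first lia.
  by have := @row_end_ge d k P d0 hk hP hT r; rewrite /row_end; lia.
(* The one of d and d + k - 1 that is not the number of parts is the degree of G. *)
pose n := (d + (d + k - 1) - size P)%N.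
have [||||F [G [e [hF [Fm szF] hG he e0]]]] := @exists_CI_cell K (size P) n (row_end P).
- by lia.
- by move=> r; apply: row_end_gt.
- by move=> r _; apply: row_endS.
- by apply: (perm_row_end d0 hk hP hT); rewrite /n; lia.
apply: (cyclic_decomp_CIJT (F := F) (G := G) (e := e) (n := n)) => //; first lia.
case: he => hspan hfree; split=> // q; rewrite hfree.
by split=> h r hr; have := h r hr; rewrite /row_end addKn.
Qed.
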